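(* Let $A$ and $B$ be Gorenstein algebras. Assume that $k$ is a splitting field for $A$ or $B$. Then $$(A\otimes_k B)\text{-}\mathsf{Gproj}=\overline{\mathsf{filt}}(A\text{-}\mathsf{Gproj}\otimes_k B\text{-}\mathsf{Gproj}).$$
   Context: $k$ is a fixed field; all algebras are finite dimensional $k$-algebras; modules are finitely generated left modules. Subcategories are full and closed under isomorphism. An algebra $\Gamma$ is Gorenstein if ${}_\Gamma\Gamma$ and $\Gamma_\Gamma$ both have finite injective dimension. The field $k$ is a splitting field for an algebra if every simple module over it has endomorphism algebra $k$. A $\Gamma$-module $G$ is Gorenstein projective if there is an exact complex $P^\bullet=(\cdots\to P^{i}\xrightarrow{d^i}P^{i+1}\to\cdots)$ of finitely generated projective $\Gamma$-modules with $G=\mathrm{Ker}\,d^1$ such that $\mathrm{Hom}_\Gamma(P^\bullet,{}_\Gamma\Gamma)$ is exact; $\Gamma\text{-}\mathsf{Gproj}$ is the full subcategory of $\Gamma\text{-mod}$ of Gorenstein projective modules. For classes $\mathscr{X}\subseteq A\text{-mod}$, $\mathscr{Y}\subseteq B\text{-mod}$, $\mathscr{X}\otimes_k\mathscr{Y}:=\{X\otimes_k Y\mid X\in\mathscr{X},Y\in\mathscr{Y}\}\subseteq (A\otimes_k B)\text{-mod}$. For a class $\mathscr{X}$ of $\Gamma$-modules, $\mathsf{filt}(\mathscr{X})$ is the full subcategory of $\Gamma\text{-mod}$ of modules $X$ admitting a finite filtration $0=X_0\subset X_1\subset\cdots\subset X_m=X$ by submodules with all $X_i/X_{i-1}$ ($1\le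 i\le m$) in $\mathscr{X}$ (up to isomorphism), and $\overline{\mathsf{filt}}(\mathscr{X})$ consists of all direct summands of modules in $\mathsf{filt}(\mathscr{X})$. *)

(* Defs.v *)
From HB Require Import structures.
From mathcomp Require Import all_boot all_order all_algebra all_field.

Set Implicit Arguments.
Unset Strict Implicit.
Unset Printing Implicit Defensive.

Import GRing.Theory VectorInternalTheory.
Local Open Scope ring_scope.

(* The tensor product of two finite dimensional algebras is built on matrices:
   coordinates of A and B being taken in the bases underlying their vectType
   structures, a (x) b is the matrix with (i, j) entry a_i b_j. *)
Section TensorSpace.
Variables (k : fieldType) (A B : vectType k).

Definition tens : Type := 'M[k]_(dim A, dim B).
HB.instance Definition _ := Vector.copy tens 'M[k]_(dim A, dim B).

Definition tpure (a : A) (b : B) : tens := (v2r a)^T *m v2r b.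

Definition tbase (V : vectType k) (i : 'I_(dim V)) : V := r2v (delta_mx 0 i).

Definition tlift (V : lmodType k) (f : A -> B -> V) (t : tens) : V :=
  \sum_i \sum_j (t : 'M_(_, _)) i j *: f (tbase i) (tbase j).

Lemma tbaseE (V : vectType k) (v : V) :
  v = \sum_i v2r v 0 i *: tbase i.
Proof.
rewrite -[LHS]v2rK {1}[v2r v]row_sum_delta linear_sum.
by apply: eq_bigr => i _; rewrite linearZ.
Qed.

Lemma tpure_linear_l b : linear (tpure^~ b).
Proof.
move=> c u v; rewrite /tpure linearP /= linearP /= mulmxDl.
by rewrite -scalemxAl.
Qed.

Lemma tpure_linear_r a : linear (tpure a).
Proof. by move=> c u v; rewrite /tpure linearP /= linearP. Qed.

Lemma tens_basis (t : tens) :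
  t = \sum_i \sum_j (t : 'M_(_, _)) i j *: tpure (tbase i) (tbase j).
Proof.
rewrite {1}[t](matrix_sum_delta (t : 'M_(_, _))).
apply: eq_bigr => i _; apply: eq_bigr => j _.
by rewrite /tpure /tbase !r2vK trmx_delta mul_delta_mx.
Qed.

Let linear_sumZ (U V : lmodType k) (f : U -> V) n (c : 'I_n -> k) v :
  linear f -> f (\sum_i c i *: v i) = \sum_i c i *: f (v i).
Proof.
move=> lf; pose F : {linear U -> V} :=
  HB.pack f (GRing.isLinear.Build _ _ _ _ f lf).
rewrite -[f]/(F : U -> V) linear_sum.
by apply: eq_bigr => i _; rewrite linearZ.
Qed.

Lemma tens_ext (V : lmodType k) (g h : tens -> V) :
    linear g -> linear h ->
  (forall a b, g (tpure a b) = h (tpure a b)) -> g =1 h.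
Proof.
move=> lg lh gh t; pose G := GRing.isLinear.Build _ _ _ _ g lg.
pose H := GRing.isLinear.Build _ _ _ _ h lh.
pose g' : {linear tens -> V} := HB.pack g G.
pose h' : {linear tens -> V} := HB.pack h H.
rewrite -[LHS]/(g' t) -[RHS]/(h' t) [t]tens_basis !linear_sum.
apply: eq_bigr => i _; rewrite !linear_sum; apply: eq_bigr => j _.
by rewrite !linearZ /= gh.
Qed.

Lemma tlift_linear (V : lmodType k) (f : A -> B -> V) : linear (tlift f).
Proof.
move=> c s t; rewrite /tlift scaler_sumr -big_split; apply: eq_bigr => i _ /=.
rewrite scaler_sumr -big_split; apply: eq_bigr => j _ /=.
by rewrite !mxE scalerDl scalerA.
Qed.

Lemma tlift_tpure (V : lmodType k) (f : A -> B -> V) :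
    (forall b, linear (f^~ b)) -> (forall a, linear (f a)) ->
  forall a b, tlift f (tpure a b) = f a b.
Proof.
move=> fl fr a b; rewrite [b in RHS]tbaseE linear_sumZ // [LHS]exchange_big /=.
apply: eq_bigr => j _; rewrite [a in RHS]tbaseE.
rewrite (linear_sumZ (f := f^~ (tbase j))) // scaler_sumr; apply: eq_bigr => i _.
by rewrite scalerA !mxE big_ord1 !mxE mulrC.
Qed.

Lemma tlift_fun (V : lmodType k) c (f g h : A -> B -> V) t :
    (forall a b, h a b = c *: f a b + g a b) ->
  tlift h t = c *: tlift f t + tlift g t.
Proof.
move=> hE; rewrite /tlift scaler_sumr -big_split; apply: eq_bigr => i _ /=.
rewrite scaler_sumr -big_split; apply: eq_bigr => j _ /=.
by rewrite hE scalerDr !scalerA mulrC.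
Qed.

End TensorSpace.

Section TensorAlgebra.
Variables (k : fieldType) (A B : falgType k).

Definition talg : Type := tens A B.
HB.instance Definition _ := Vector.copy talg (tens A B).

Local Notation "a # b" := (tpure a b : talg) (at level 39).

Definition tone : talg := 1 # 1.

Definition tmul (s t : talg) : talg :=
  tlift (fun a b => tlift (fun a' b' => (a * a') # (b * b')) t) s.

Let tpl c (a a' : A) (b : B) : (c *: a + a') # b = c *: (a # b) + a' # b.
Proof. exact: (tpure_linear_l b). Qed.

Let tpr c (a : A) (b b' : B) : a # (c *: b + b') = c *: (a # b) + a # b'.
Proof. exact: (tpure_linear_r a). Qed.

Lemma tmul_tpure a b a' b' : tmul (a # b) (a' # b') = (a * a') # (b * b').
Proof.
rewrite /tmul tlift_tpure => [|y c u v|x c u v]; first rewrite tlift_tpure //.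
- by move=> y c u v; rewrite mulrDr -scalerAr tpl.
- by move=> x c u v; rewrite mulrDr -scalerAr tpr.
- by apply: tlift_fun => x z; rewrite mulrDl -scalerAl tpl.
- by apply: tlift_fun => z y; rewrite mulrDl -scalerAl tpr.
Qed.

Lemma tmul_linear_l t : linear (tmul^~ t).
Proof. by move=> c u v; rewrite /tmul tlift_linear. Qed.

Lemma tmul_linear_r s : linear (tmul s).
Proof.
by move=> c u v; apply: tlift_fun => a b; rewrite tlift_linear.
Qed.

Let tmulDl : left_distributive tmul +%R.
Proof.
by move=> s t u; have := tmul_linear_l u 1 s t; rewrite !scale1r.
Qed.

Let tmulDr : right_distributive tmul +%R.
Proof.
by move=> s t u; have := tmul_linear_r s 1 t u; rewrite !scale1r.
Qed.

Let tmul1 : left_id tone tmul.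
Proof.
apply: tens_ext => [|//|a b]; first exact: tmul_linear_r.
by rewrite tmul_tpure !mul1r.
Qed.

Let tmulr1 : right_id tone tmul.
Proof.
apply: (tens_ext (g := tmul^~ tone)) => [|//|a b]; first exact: tmul_linear_l.
by rewrite tmul_tpure !mulr1.
Qed.

Let tmulA : associative tmul.
Proof.
move=> s t u; move: s.
apply: (tens_ext (g := fun s => tmul s (tmul t u))
                 (h := fun s => tmul (tmul s t) u)) => [||a b].
- exact: tmul_linear_l.
- by move=> c x y; rewrite !tmul_linear_l.
move: t; apply: (tens_ext (g := fun t => tmul (a # b) (tmul t u))
                  (h := fun t => tmul (tmul (a # b) t) u)) => [||a' b'].
- by move=> c x y; rewrite tmul_linear_l tmul_linear_r.
- by move=> c x y; rewrite tmul_linear_r tmul_linear_l.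
move: u; apply: (tens_ext (g := fun u => tmul (a # b) (tmul (a' # b') u))
                  (h := fun u => tmul (tmul (a # b) (a' # b')) u)) => [||? ?].
- by move=> c x y; rewrite !tmul_linear_r.
- exact: tmul_linear_r.
by rewrite !tmul_tpure !mulrA.
Qed.

Let tone_neq0 : tone != 0.
Proof.
have /rV0Pn[i i1] : v2r (1 : A) != 0.
  by rewrite -(inj_eq (@r2v_inj _ _)) v2rK linear0 oner_neq0.
have /rV0Pn[j j1] : v2r (1 : B) != 0.
  by rewrite -(inj_eq (@r2v_inj _ _)) v2rK linear0 oner_neq0.
apply: contra_neq (mulf_neq0 i1 j1) => /matrixP/(_ i j).
by rewrite !mxE big_ord1 !mxE.
Qed.

HB.instance Definition _ := GRing.Zmodule_isNzRing.Build talg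
  tmulA tmul1 tmulr1 tmulDl tmulDr tone_neq0.

Let tscaleAl (c : k) (s t : talg) : c *: (s * t) = (c *: s) * t.
Proof.
rewrite -[RHS]/(tmul _ t) -[c *: s]addr0 [RHS]tmul_linear_l.
by rewrite -[tmul 0 t]/(0 * t) mul0r addr0.
Qed.

HB.instance Definition _ := GRing.Lmodule_isLalgebra.Build k talg tscaleAl.

Let tscaleAr (c : k) (s t : talg) : c *: (s * t) = s * (c *: t).
Proof.
rewrite -[RHS]/(tmul s _) -[c *: t]addr0 [RHS]tmul_linear_r.
by rewrite -[tmul s 0]/(s * 0) mulr0 addr0.
Qed.

HB.instance Definition _ := GRing.Lalgebra_isAlgebra.Build k talg tscaleAr.
HB.instance Definition _ := Algebra_isFalgebra.Build k talg.

Lemma tpure11 : 1 # 1 = 1.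
Proof. by []. Qed.

Lemma tpureM a b a' b' : (a # b) * (a' # b') = (a * a') # (b * b').
Proof. exact: tmul_tpure. Qed.

End TensorAlgebra.

Notation "A ⊗ B" := (talg A B) (at level 40, left associativity) : type_scope.

Section Modules.
Variable R : pzRingType.

Definition fin_gen (M : lmodType R) : Prop :=
  exists n (v : 'I_n -> M), forall x, exists c : 'I_n -> R,
    x = \sum_(i < n) c i *: v i.

Record fgmod := FgMod { fgmod_sort :> lmodType R; fgmodP : fin_gen fgmod_sort }.

Lemma regular_fin_gen : fin_gen (R^o : lmodType R).
Proof.
by exists 1, (fun=> 1) => x; exists (fun=> x); rewrite big_ord1 [RHS]mulr1.
Qed.

Definition regmod : fgmod := FgMod regular_fin_gen.

Definition exact (U V W : lmodType R) (f : U -> V) (g : V -> W) : Prop :=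
  forall v, g v = 0 <-> exists u, f u = v.

Definition projective (P : fgmod) : Prop :=
  forall (X Y : fgmod) (p : {linear X -> Y}) (f : {linear P -> Y}),
    (forall y, exists x, p x = y) -> exists h : {linear P -> X}, p \o h =1 f.

Definition injective_mod (I : fgmod) : Prop :=
  forall (X Y : fgmod) (i : {linear X -> Y}) (f : {linear X -> I}),
    injective i -> exists h : {linear Y -> I}, h \o i =1 f.

(* An exact sequence 0 -> M -> I 0 -> ... -> I n -> 0 with injective terms. *)
Definition finite_injdim (M : fgmod) : Prop :=
  exists (n : nat) (I : nat -> fgmod) (d : forall i, {linear I i -> I i.+1})
         (e : {linear M -> I 0%N}),
    [/\ forall i, injective_mod (I i),
        forall i, (n < i)%N -> forall x : I i, x = 0,
        injective e,
        exact e (d 0%N)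
      & forall i, exact (d i) (d i.+1)].

Definition gproj (G : fgmod) : Prop :=
  exists (P : int -> fgmod) (d : forall i, {linear P i -> P (i + 1)}),
    [/\ forall i, projective (P i),
        forall i, exact (d i) (d (i + 1)),
        forall i (f : {linear P (i + 1) -> regmod}),
          (f \o d i =1 \0) <->
          exists h : {linear P (i + 1 + 1) -> regmod}, h \o d (i + 1) =1 f
      & exists e : {linear G -> P 1}, injective e /\ exact e (d 1)].

Definition simple_mod (M : lmodType R) : Prop :=
  (exists x : M, x != 0) /\
  forall S : {pred M}, GRing.submod_closed S ->
    S =i pred1 0 \/ S =i predT.

Definition isomorphic (M N : lmodType R) : Prop :=
  exists f : {linear M -> N}, bijective f.

(* For submodules S' of S of M: the module S / S' is isomorphic to Q. Only the
   restriction of p to S matters. *)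
Definition subquotient (M Q : lmodType R) (S S' : {pred M}) : Prop :=
  exists p : M -> Q,
    [/\ forall a, {in S &, forall x y, p (a *: x + y) = a *: p x + p y},
        forall q, exists2 x, x \in S & p x = q
      & {in S, forall x, p x = 0 <-> x \in S'}].

Definition filt (C : fgmod -> Prop) (X : fgmod) : Prop :=
  exists (m : nat) (F : nat -> {pred X}),
    [/\ forall i, GRing.submod_closed (F i),
        F 0%N =i pred1 0,
        F m =i predT
      & forall i, (i < m)%N -> {subset F i <= F i.+1} /\
          exists2 Q : fgmod, C Q & subquotient Q (F i.+1) (F i)].

Definition filtbar (C : fgmod -> Prop) (X : fgmod) : Prop :=
  exists Y Z : fgmod, filt C Y /\ isomorphic Y (X * Z)%type.

End Modules.

(* Right modules over R are left modules over the converse ring R^c. *)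
Definition gorenstein (R : pzRingType) : Prop :=
  finite_injdim (regmod R) /\ finite_injdim (regmod R^c).

Section Restriction.
Variables (k : fieldType) (A : algType k) (M : lmodType A).

Definition restr : Type := M.
HB.instance Definition _ := GRing.Zmodule.on restr.

Let rscale (c : k) (x : restr) : restr := c%:A *: (x : M).

Let rscaleA a b v : rscale a (rscale b v) = rscale (a * b) v.
Proof. by rewrite /rscale scalerA -scalerAl mul1r scalerA. Qed.

Let rscale1 : left_id 1 rscale.
Proof. by move=> v; rewrite /rscale !scale1r. Qed.

Let rscaleDr : right_distributive rscale +%R.
Proof. by move=> c u v; rewrite /rscale scalerDr. Qed.

Let rscaleDl v : {morph rscale^~ v : a b / a + b}.
Proof. by move=> a b; rewrite /rscale !scalerDl. Qed.

HB.instance Definition _ := GRing.Zmodule_isLmodule.Build k restr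
  rscaleA rscale1 rscaleDr rscaleDl.

End Restriction.

(* The scalar c : k acts on a module as c *: 1; the requirement is that k maps
   bijectively onto the endomorphism algebra of each simple module. *)
Definition splitting_field (k : fieldType) (A : algType k) : Prop :=
  forall S : fgmod A, simple_mod S ->
    forall f : {linear S -> S}, exists! c : k, f =1 (fun x => c%:A *: x).

Section TensorModules.
Variables (k : fieldType) (A B : falgType k).

(* Z is the tensor product over k of X and Y (with universal bilinear map t),
   with (a (x) b) (x (x) y) = a x (x) b y. *)
Definition is_tensor (X : lmodType A) (Y : lmodType B) (Z : lmodType (A ⊗ B))
    : Prop :=
  exists t : {bilinear restr X -> restr Y -> restr Z},
    (forall (V : lmodType k) (f : {bilinear restr X -> restr Y -> V}),
       exists g : {linear restr Z -> V},
         (forall x y, g (t x y) = f x y) /\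
         forall g' : {linear restr Z -> V},
           (forall x y, g' (t x y) = f x y) -> g' =1 g) /\
    forall (a : A) (b : B) (x : X) (y : Y),
      (tpure a b : A ⊗ B) *: (t x y : Z) = t (a *: x) (b *: y).

Definition tensor_class (C : fgmod A -> Prop) (D : fgmod B -> Prop)
    (Z : fgmod (A ⊗ B)) : Prop :=
  exists (X : fgmod A) (Y : fgmod B), [/\ C X, D Y & is_tensor X Y Z].

End TensorModules.

(* Main.v *)
From HB Require Import structures.
Require Import Defs.
From mathcomp Require Import all_boot all_order all_algebra all_field boolp.

Set Implicit Arguments.
Unset Strict Implicit.
Unset Printing Implicit Defensive.

Import GRing.Theory VectorInternalTheory.
Local Open Scope ring_scope.

(** Over a Gorenstein algebra a module is Gorenstein projective if and only if
    it has a coresolution by projectives; such modules are closed under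
    extensions and direct summands, and X ⊗ Y is one of them when X and Y are,
    by exactness of the tensor product. Conversely, the Gorenstein dimensions
    of all modules over A and over B are bounded. When k splits B, a nonzero
    A ⊗ B-module N contains Hom_B(S, N) ⊗ S for a simple B-submodule S of N, by
    Schur's lemma, so for some n every module is filtered by products X ⊗ Y
    with gdim X + gdim Y <= n. A syzygy of such a product, taken in one
    variable at a time, is an extension of two products for n - 1. By the
    horseshoe and Schanuel lemmas, n-th syzygies, in particular Gorenstein
    projective modules, are summands of modules filtered by products for
    n = 0. *)

(** * Finite dimensional modules *)

(** No derived functors or total complexes are built: Ext^1 enters only as an extension property,
    and long sequences are replaced by classes of modules closed under single short exact steps.
    Projective covers extend a coresolution to the left for free; what makes its dual exact is that
    Ext^1(-, R) vanishes on all cosyzygies when the regular module has finite injective dimension.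
    For A ⊗ B this finiteness needs tensor products of injectives to be injective, which is obtained
    from a criterion in the style of dual bases. The two halves of the Gorenstein hypothesis act
    separately: the left regular module gives the Ext vanishing, while the k-dual of the right
    regular module is a cogenerator of finite projective dimension, which bounds the Gorenstein
    dimensions. The splitting hypothesis is what makes the evaluation Hom_B(S, N) ⊗ S → N injective:
    a larger endomorphism algebra of S would create a kernel as soon as Hom_B(S, N) is nonzero. *)

Definition lin_of (R : pzRingType) (U V : lmodType R) (f : U -> V)
    (lf : linear f) : {linear U -> V} :=
  HB.pack f (GRing.isLinear.Build _ _ _ _ f lf).

Section FiniteDimension.
Variables (k : fieldType) (R : falgType k).
Implicit Types M N : fgmod R.

Lemma restr_linear M N (f : {linear M -> N}) :
  linear (f : restr M -> restr N).
Proof. by move=> c x y; exact: linearP. Qed.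

Definition restr_lin M N (f : {linear M -> N}) : {linear restr M -> restr N} :=
  lin_of (restr_linear f).

Lemma fgmod_spanning M : exists n (q : {linear 'rV[k]_n -> restr M}),
  forall y, exists x, q x = y.
Proof.
have [n [v vP]] := fgmodP M.
pose f (u : 'rV[k]_(n * dim R)) : restr M :=
  \sum_i (r2v (row i (vec_mx u)) : R) *: v i.
have lf : linear f.
  move=> c x y; rewrite /f scaler_sumr -big_split; apply: eq_bigr => i _ /=.
  by rewrite !linearP /= scalerDl -mulr_algl -scalerA.
exists _, (lin_of lf) => y; have [c cE] := vP y.
exists (mxvec (\matrix_i v2r (c i))); rewrite [RHS]cE; apply: eq_bigr => i _.
by rewrite mxvecK rowK v2rK.
Qed.

Lemma fgmod_coordinates M : exists n (q : {linear 'rV[k]_n -> restr M}),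
  bijective q.
Proof.
have ex : exists n, `[< exists q : {linear 'rV[k]_n -> restr M},
    forall y, exists x, q x = y >].
  by have [n nP] := fgmod_spanning M; exists n; apply/asboolP.
case: (ex_minnP ex) => n /asboolP[q qs] min_n; exists n, q.
suff qi : injective q.
  have [s sK] := choice qs.
  by exists s => x; [apply: qi; rewrite sK|rewrite sK].
apply: raddf_inj => u qu; apply: contrapT => /eqP/rV0Pn[i ui].
case: n q qs min_n u qu i ui => [|n] q qs min_n u qu i ui; first by case: i ui.
suff: (n < n)%N by rewrite ltnn.
apply: min_n; apply/asboolP.
pose f (w : 'rV[k]_n) : restr M :=
  q (\row_j if unlift i j is Some l then w 0 l else 0).
have lf : linear f.
  move=> c x y; rewrite /f -linearP; congr (q _); apply/rowP => j; rewrite !mxE.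
  by case: unlift => [l|]; rewrite ?mxE // mulr0 addr0.
exists (lin_of lf) => y; have [x xE] := qs y.
(* Subtracting a multiple of the kernel vector [u] clears coordinate [i] without changing the
   image. *)
have /= xE' : q (x - (x 0 i / u 0 i) *: u) = y.
  by rewrite linearB linearZ /= qu scaler0 subr0.
exists (col' i (x - (x 0 i / u 0 i) *: u)); rewrite -[RHS]xE' /= /f.
congr (q _); apply/rowP => j; rewrite !mxE.
by case: unliftP => [l|] -> /=; rewrite ?mxE // divfK // subrr.
Qed.

Lemma restr_vector_axiom M : {n : nat & Vector.axiom n (restr M)}.
Proof.
suff /cid[n /cid2[f lf bf]] : exists n, exists2 f : restr M -> 'rV[k]_n,
    linear f & bijective f by exists n, f.
have [n [q [r rK qK]]] := fgmod_coordinates M.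
exists n, r; last by exists q.
exact: can2_linear rK qK.
Qed.

HB.instance Definition _ M := Lmodule_hasFinDim.Build k (restr M)
  (projT2 (restr_vector_axiom M)).

End FiniteDimension.

Section ActionModule.
Variables (k : fieldType) (R : falgType k).

Record action (V : lmodType k) := Action {
  act_fun :> R -> V -> V;
  act_linear_l : forall v, linear (act_fun^~ v);
  act_linear_r : forall a, linear (act_fun a);
  actM : forall a b v, act_fun (a * b) v = act_fun a (act_fun b v);
  act1 : forall v, act_fun 1 v = v }.

(** The action is a phantom argument, so that each action on [V] has a type of its own to carry its
    module structure. The k-structure recovered by [restr] agrees with that of [V] only up to a
    proof, [restr_actmod]. *)
Definition actmod (V : vectType k) (act : action V) : Type := V.

Section Def.
Variables (V : vectType k) (act : action V).

HB.instance Definition _ := GRing.Zmodule.copy (actmod act) V.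

Let actA a b v : act a (act b v) = act (a * b) v.
Proof. by rewrite actM. Qed.

Let act_1 : left_id 1 act. Proof. exact: act1. Qed.

Let actDr : right_distributive act +%R.
Proof. by move=> c u v; have := act_linear_r act c 1 u v; rewrite !scale1r. Qed.

Let actDl v : {morph act^~ v : a b / a + b}.
Proof. by move=> a b; have := act_linear_l act v 1 a b; rewrite !scale1r. Qed.

HB.instance Definition _ := GRing.Zmodule_isLmodule.Build R (actmod act)
  actA act_1 actDr actDl.

Lemma actmod_scale a (v : actmod act) : a *: v = act a (v : V).
Proof. by []. Qed.

Lemma act_scalar c v : act c%:A v = c *: v.
Proof.
by rewrite -[LHS]/(lin_of (act_linear_l act v) _) linearZ /= act1.
Qed.

Lemma restr_actmod c (v : restr (actmod act)) : c *: v = (c *: (v : V)).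
Proof. exact: act_scalar. Qed.

Lemma actmod_fin_gen : fin_gen (actmod act).
Proof.
exists (dim V), (fun i => tbase i) => x; exists (fun i => (v2r (x : V) 0 i)%:A).
rewrite [LHS](tbaseE (x : V)); apply: eq_bigr => i _.
by rewrite [RHS]act_scalar.
Qed.

Definition actfg := FgMod actmod_fin_gen.
End Def.
End ActionModule.

(** * Submodules and quotient modules *)

Section SubQuotient.
Variables (k : fieldType) (R : falgType k).
Implicit Types M N : fgmod R.

Lemma restrZl M c (a : R) (x : M) : (c *: a) *: x = c *: (a *: x : restr M).
Proof. by rewrite -mulr_algl -scalerA. Qed.

Lemma restrZC M c (a : R) (x : restr M) :
  a *: (c *: x : M) = c *: (a *: (x : M) : restr M).
Proof. by rewrite -restrZl [LHS]scalerA -scalerAr mulr1. Qed.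

(** A subspace of maximal dimension inside [S] exhausts [S], as any further vector of [S] could be
    adjoined to it. *)
Lemma submod_closed_vspace (V : vectType k) (S : {pred V}) :
  GRing.submod_closed S -> exists U : {vspace V}, U =i S.
Proof.
move=> [S0 Sl].
have ex : exists n, `[< exists2 U : {vspace V}, {subset U <= S} & \dim U = n >].
  exists 0%N; apply/asboolP; exists 0%VS; last exact: dimv0.
  by move=> x; rewrite memv0 => /eqP ->.
have bd n : `[< exists2 U : {vspace V}, {subset U <= S} & \dim U = n >] ->
    (n <= \dim {:V})%N.
  by move=> /asboolP[U _ <-]; apply/dimvS/subvf.
case: (ex_maxnP ex bd) => n /asboolP[U US Un] max_n; exists U => x.
apply/idP/idP => [/US //|xS]; apply: contrapT => /negP xU.
suff /max_n : `[< exists2 U : {vspace V}, {subset U <= S} & \dim U = n.+1 >].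
  by rewrite ltnn.
apply/asboolP; exists (<[x]> + U)%VS.
  by move=> _ /memv_addP[_ /vlineP[c ->] [u /US uS ->]]; apply: Sl.
rewrite dimv_disjoint_sum ?Un ?dim_vline.
  by rewrite eq_sym (memPn xU) ?mem0v.
apply/eqP; rewrite -subv0; apply/subvP => _ /memv_capP[/vlineP[c ->] cU].
rewrite memv0 scaler_eq0; apply/orP; left; apply: contraR xU => c0.
by rewrite -[x](scalerK c0) memvZ.
Qed.

Lemma submod_vspace M (S : {pred M}) : GRing.submod_closed S ->
  exists U : {vspace restr M}, U =i S /\ forall a u, u \in U -> a *: (u : M) \in U.
Proof.
move=> [S0 Sl]; have [|U US] := @submod_closed_vspace (restr M) S.
  by split=> // c x y; exact: Sl.
exists U; split=> // a u; rewrite !US => uS.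
by rewrite -[a *: _]addr0 Sl.
Qed.

Lemma submodule M (S : {pred M}) : GRing.submod_closed S ->
  exists (K : fgmod R) (i : {linear K -> M}),
    injective i /\ forall x, x \in S <-> exists u, i u = x.
Proof.
move=> /submod_vspace[U [US UR]].
pose V : vectType k := subvs_of U.
pose f (a : R) (u : V) : V := vsproj U (a *: (vsval u : M)).
have fE a u : vsval (f a u) = a *: (vsval u : M).
  by rewrite vsprojK // UR // subvsP.
have f1 v : linear (f^~ v).
  move=> c a b; apply: val_inj; rewrite /= !fE.
  by rewrite scalerDl -restrZl.
have f2 a : linear (f a).
  move=> c u v; apply: val_inj; rewrite /= !fE linearP /=.
  by rewrite scalerDr restrZC.
have f3 a b v : f (a * b) v = f a (f b v).
  by apply: val_inj; rewrite /= !fE scalerA.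
have f4 v : f 1 v = v by apply: val_inj; rewrite /= fE scale1r.
pose act := Action f1 f2 f3 f4.
have li : linear ((fun u => vsval u) : actfg act -> M).
  by move=> a u v; rewrite [LHS]linearD /= [X in X + _]fE.
exists (actfg act), (lin_of li); split=> [|x]; first exact: val_inj.
rewrite -US; split=> [xU|[u <-]]; last exact: subvsP.
by exists (vsproj U x); rewrite /= vsprojK.
Qed.

(** The quotient is carried by a linear complement of the submodule: [R] acts in [M], and the result
    is projected back. *)
Lemma quotient_module M (S : {pred M}) : GRing.submod_closed S ->
  exists (Q : fgmod R) (p : {linear M -> Q}),
    (forall y, exists x, p x = y) /\ forall x, x \in S <-> p x = 0.
Proof.
move=> /submod_vspace[U [US UR]].
pose V : vectType k := subvs_of (U^C)%VS.
pose p (x : restr M) : V := vsproj _ (daddv_pi (U^C) U x).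
have lp : linear p by move=> c x y; rewrite /p !linearP.
pose pl := lin_of lp.
have pE x : vsval (p x) = daddv_pi (U^C) U x by rewrite vsprojK ?memv_pi.
have dU : (U^C :&: U = 0)%VS by rewrite capvC capv_compl.
have addE (x : restr M) : daddv_pi (U^C) U x + daddv_pi U (U^C) x = x.
  by apply: daddv_pi_add; rewrite // addvC addv_complf memvf.
have px0 x : x \in U <-> p x = 0.
  split=> [xU|px].
    apply: val_inj; rewrite /= pE; apply: (addIr x).
    by rewrite add0r -[RHS]addE (daddv_pi_id (capv_compl U) xU).
  by rewrite -[x]addE -pE px raddf0 add0r memv_pi.
have pK (v : V) : p (vsval v) = v.
  by apply: val_inj; rewrite /= pE daddv_pi_id // subvsP.
(* The projection kills exactly the submodule [U], so the action is well defined modulo [U];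
   associativity and the R-linearity of [p] both rest on this. *)
have pR a (x y : restr M) : p x = p y -> p (a *: (x : M)) = p (a *: (y : M)).
  move=> /eqP; rewrite -subr_eq0 -[_ - _](linearB pl) => /eqP/px0/(UR a).
  by rewrite scalerBr => /px0/eqP; rewrite [p _](linearB pl) subr_eq0 => /eqP.
pose f (a : R) (v : V) : V := p (a *: (vsval v : M)).
have f1 v : linear (f^~ v).
  move=> c a b; rewrite /f scalerDl restrZl; exact: (linearP pl).
have f2 a : linear (f a).
  move=> c u v; rewrite /f linearP /= -[RHS](linearP pl); congr (p _).
  by rewrite scalerDr restrZC.
have f3 a b v : f (a * b) v = f a (f b v).
  by rewrite /f -scalerA; apply: pR; rewrite pK.
have f4 v : f 1 v = v by rewrite /f scale1r pK.
pose act := Action f1 f2 f3 f4.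
have lR : linear (p : M -> actfg act).
  move=> a x y; have := linearD pl (a *: (x : M)) y => /= ->; congr (_ + _).
  by rewrite actmod_scale; apply: pR; rewrite pK.
exists (actfg act), (lin_of lR); split=> [y|x]; first by exists (vsval y);
  exact: pK.
by rewrite -US.
Qed.
End SubQuotient.

(** * Exact sequences *)

Section Exactness.
Variables (k : fieldType) (R : falgType k).
Implicit Types K L M N P Q X Y Z : fgmod R.

Definition ses X Y Z (f : {linear X -> Y}) (g : {linear Y -> Z}) : Prop :=
  [/\ injective f, exact f g & forall z, exists y, g y = z].

Definition is_ses X Y Z : Prop :=
  exists (f : {linear X -> Y}) (g : {linear Y -> Z}), ses f g.

Lemma ses_comp0 X Y Z (f : {linear X -> Y}) (g : {linear Y -> Z}) x :
  ses f g -> g (f x) = 0.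
Proof. by case=> _ fg _; apply/fg; exists x. Qed.

Lemma lin_inj X Y (f : {linear X -> Y}) :
  (forall x, f x = 0 -> x = 0) -> injective f.
Proof.
move=> f0 x y xy; apply/eqP; rewrite -subr_eq0; apply/eqP/f0.
by rewrite linearB /= xy subrr.
Qed.

Lemma inj0 X Y (f : {linear X -> Y}) x : injective f -> f x = 0 -> x = 0.
Proof. by move=> fi fx; apply: fi; rewrite fx linear0. Qed.

(** Preimages under an injective map are unique, so any choice of them is automatically linear. *)
Lemma lift_inj K X Z (i : {linear K -> X}) (f : {linear Z -> X}) :
    injective i -> (forall z, exists u, i u = f z) ->
  exists g : {linear Z -> K}, forall z, i (g z) = f z.
Proof.
move=> ii /choice[g gE]; have lg : linear g.
  by move=> a x y; apply: ii; rewrite linearP !gE linearP.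
by exists (lin_of lg).
Qed.

Lemma factor_surj X Y Z (p : {linear X -> Y}) (f : {linear X -> Z}) :
    (forall y, exists x, p x = y) -> (forall x, p x = 0 -> f x = 0) ->
  exists g : {linear Y -> Z}, forall x, g (p x) = f x.
Proof.
move=> ps pf; have [s sK] := choice ps.
have fE x y : p x = p y -> f x = f y.
  move=> xy; apply/eqP; rewrite -subr_eq0 -linearB pf //.
  by rewrite linearB /= xy subrr.
have lg : linear (f \o s).
  by move=> a x y; rewrite /= -linearP; apply: fE; rewrite linearP /= !sK.
by exists (lin_of lg) => x /=; apply: fE.
Qed.

Lemma kernel_ex X Y (g : {linear X -> Y}) :
  exists (K : fgmod R) (i : {linear K -> X}), injective i /\ exact i g.
Proof.
have cl : GRing.submod_closed [pred x : X | g x == 0].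
  split=> [|a x y]; rewrite !inE ?linear0 //.
  by rewrite linearP => /eqP -> /eqP ->; rewrite scaler0 addr0.
have [K [i [ii iE]]] := submodule cl; exists K, i; split=> // x.
by rewrite -iE inE; split=> [->|/eqP].
Qed.

Lemma kernel_ses X Y (g : {linear X -> Y}) :
  (forall y, exists x, g x = y) -> exists (K : fgmod R) (i : {linear K ->
    X}), ses i g.
Proof. by move=> gs; have [K [i [ii iE]]] := kernel_ex g; exists K, i. Qed.

Lemma cokernel_ses X Y (f : {linear X -> Y}) :
  injective f -> exists (Z : fgmod R) (g : {linear Y -> Z}), ses f g.
Proof.
move=> fi; pose S := [pred y | `[< exists x, f x = y >]].
have cl : GRing.submod_closed S.
  split=> [|a x y]; first by apply/asboolP; exists 0; rewrite linear0.
  rewrite !inE => /asboolP[u <-] /asboolP[v <-]; apply/asboolP.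
  by exists (a *: u + v); rewrite linearP.
have [Z [g [gs gE]]] := quotient_module cl; exists Z, g; split=> // y.
by rewrite -gE; split=> [/asboolP|] //; move=> h; apply/asboolP.
Qed.

Lemma image_factor X Y (f : {linear X -> Y}) :
  exists (I : fgmod R) (p : {linear X -> I}) (i : {linear I -> Y}),
    [/\ forall y, exists x, p x = y, injective i & forall x, i (p x) = f x].
Proof.
have [K [j [ji jE]]] := kernel_ex f; have [I [p [_ pE ps]]] := cokernel_ses ji.
have [|i iE] := @factor_surj _ _ _ p f ps.
  by move=> x /pE[u <-]; apply/jE; exists u.
exists I, p, i; split=> //; apply: lin_inj => y; have [x <-] := ps y.
by rewrite iE => /jE[u <-]; apply/pE; exists u.
Qed.

Lemma prod_fin_gen X Y : fin_gen (X * Y)%type.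
Proof.
have [n [v vP]] := fgmodP X; have [m [w wP]] := fgmodP Y.
exists (n + m)%N, (fun i => match split i with inl j => (v j, 0) | inr j =>
  (0, w j) end).
move=> [x y]; have [c xE] := vP x; have [d yE] := wP y.
exists (fun i => match split i with inl j => c j | inr j => d j end).
rewrite big_split_ord /=; under eq_bigr => i _.
  rewrite (unsplitK (inl i : 'I_n + 'I_m)); over.
under [X in _ + X]eq_bigr => i _.
  rewrite (unsplitK (inr i : 'I_n + 'I_m)); over.
apply: injective_projections; rewrite [RHS]/= ?raddfD /=.
  rewrite (raddf_sum (@fst X Y)) (raddf_sum (@fst X Y)) /= [X in _ + X]big1
    ?addr0 //.
  by move=> i _; rewrite scaler0.
rewrite (raddf_sum (@snd X Y)) (raddf_sum (@snd X Y)) /= [X in X + _]big1 ?add0r //.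
by move=> i _; rewrite scaler0.
Qed.

Definition fgprod X Y : fgmod R := FgMod (@prod_fin_gen X Y).

Lemma fst_linear X Y : linear (fun z : fgprod X Y => z.1 : X).
Proof. by []. Qed.
Lemma snd_linear X Y : linear (fun z : fgprod X Y => z.2 : Y).
Proof. by []. Qed.
Definition fstl X Y := lin_of (@fst_linear X Y).
Definition sndl X Y := lin_of (@snd_linear X Y).

Lemma pair_linear X Y Z (f : {linear Z -> X}) (g : {linear Z -> Y}) :
  linear (fun z => (f z, g z) : fgprod X Y).
Proof. by move=> a x y /=; rewrite !linearP. Qed.
Definition pairl X Y Z (f : {linear Z -> X}) (g : {linear Z -> Y}) :=
  lin_of (pair_linear f g).

Lemma copair_linear X Y Z (f : {linear X -> Z}) (g : {linear Y -> Z}) :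
  linear (fun z : fgprod X Y => f z.1 + g z.2).
Proof. by move=> a x y /=; rewrite !linearP /= scalerDr addrACA. Qed.
Definition copairl X Y Z (f : {linear X -> Z}) (g : {linear Y -> Z}) :=
  lin_of (copair_linear f g).

Definition lin_id X : {linear X -> X} := idfun.
Definition lin0 X Y : {linear X -> Y} := \0.
Definition inll X Y : {linear X -> fgprod X Y} := pairl (lin_id X) (lin0 X Y).
Definition inrl X Y : {linear Y -> fgprod X Y} := pairl (lin0 Y X) (lin_id Y).
Definition prodl X Y X' Y' (f : {linear X -> X'}) (g : {linear Y -> Y'}) :
    {linear fgprod X Y -> fgprod X' Y'} :=
  pairl (f \o @fstl X Y) (g \o @sndl X Y).

Lemma ses_prod X Y Z X' Y' Z' (f : {linear X -> Y}) (g : {linear Y -> Z})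
    (f' : {linear X' -> Y'}) (g' : {linear Y' -> Z'}) :
  ses f g -> ses f' g' -> ses (prodl f f') (prodl g g').
Proof.
move=> [fi fg gs] [fi' fg' gs']; split.
- by move=> [x x'] [y y'] /= [/fi -> /fi' ->].
- move=> [y y'] /=; split=> [[/fg[x <-] /fg'[x' <-]]|[[x x'] /= [<- <-]]].
    by exists (x, x').
  by congr (_, _); [apply/fg; exists x|apply/fg'; exists x'].
- by move=> [z z']; have [y <-] := gs z; have [y' <-] := gs' z'; exists (y, y').
Qed.

Lemma is_ses_prod X Y Z X' Y' Z' : is_ses X Y Z -> is_ses X' Y' Z' ->
  is_ses (fgprod X X') (fgprod Y Y') (fgprod Z Z').
Proof.
by move=> [f [g fg]] [f' [g' fg']]; exists (prodl f f'), (prodl g g');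
  apply: ses_prod.
Qed.

Lemma ses_split X Y : ses (inll X Y) (@sndl X Y).
Proof.
split=> [x y [] //||y]; last by exists (0, y).
by move=> [x y] /=; split=> [->|[u [_ <-]] //]; exists x.
Qed.

Lemma pullback_ex X Y Z (f : {linear X -> Z}) (g : {linear Y -> Z}) :
  exists (E : fgmod R) (p : {linear E -> X}) (q : {linear E -> Y}),
    [/\ forall e, f (p e) = g (q e),
        forall x y, f x = g y -> exists e, p e = x /\ q e = y
      & forall e, p e = 0 -> q e = 0 -> e = 0].
Proof.
have [E [i [ii iE]]] := kernel_ex (copairl f (\- g)).
exists E, (@fstl X Y \o i), (@sndl X Y \o i); split=> /=.
- move=> e; apply/eqP; rewrite -subr_eq0; apply/eqP.
  by rewrite -[LHS]/(copairl f (\- g) (i e)); apply/iE; exists e.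
- move=> x y xy; have /iE[e eE] : copairl f (\- g) (x, y) = 0.
    by rewrite /= xy subrr.
  by exists e; rewrite eE.
- by move=> e e1 e2; apply: (inj0 ii); case: (i e) e1 e2 => x y /= -> ->.
Qed.

Lemma pullback_ses K Y Z X (f : {linear K -> Y}) (g : {linear Y -> Z})
    (h : {linear X -> Z}) : ses f g ->
  exists (E : fgmod R) (j : {linear K -> E}) (p : {linear E ->
    X}) (q : {linear E -> Y}),
    [/\ ses j p, forall e, h (p e) = g (q e) & forall u, q (j u) = f u].
Proof.
move=> sfg; case: (sfg) => fi fg gs.
have [E [p [q [pqE pqs pqi]]]] := pullback_ex h g.
have [K' [j' [j'i j'E]]] := kernel_ex p.
have [||r rE] := @lift_inj _ _ _ (pairl p q) (pairl (lin0 K X) f).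
- by apply: lin_inj => e /= [? ?]; exact: pqi.
- move=> u; have [|e [pe qe]] := pqs 0 (f u); last by exists e; rewrite /= pe qe.
  by rewrite linear0 (ses_comp0 _ sfg).
exists E, r, p, q; split=> //; last by move=> u; have [_ ->] := rE u.
split=> [|e|x].
- by apply: lin_inj => u ru; apply: (inj0 fi); have [_ <-] := rE u;
  rewrite ru linear0.
- split=> [pe|[u <-]]; last by have [-> _] := rE u.
  have /fg[u uE] : g (q e) = 0 by rewrite -pqE pe linear0.
  exists u; apply/eqP; rewrite -subr_eq0; apply/eqP; apply: pqi.
    by rewrite linearB /=; have [-> _] := rE u; rewrite pe subrr.
  by rewrite linearB /=; have [_ ->] := rE u; rewrite uE subrr.
- by have [y yE] := gs (h x); have [e [<- _]] := pqs x y (esym yE); exists e.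
Qed.

Lemma free_fin_gen n : fin_gen ('rV[R]_n : lmodType R).
Proof.
exists n, (fun i => delta_mx 0 i) => x; exists (fun i => x 0 i).
exact: row_sum_delta.
Qed.

Definition free_mod n : fgmod R := FgMod (free_fin_gen n).

Lemma free_map_linear n M (v : 'I_n -> M) :
  linear (fun x : free_mod n => \sum_i x 0 i *: v i).
Proof.
move=> a x y; rewrite scaler_sumr -big_split; apply: eq_bigr => i _ /=.
by rewrite !mxE scalerDl scalerA.
Qed.
Definition free_map n M (v : 'I_n -> M) := lin_of (free_map_linear v).

Lemma free_map_delta n M (v : 'I_n -> M) i : free_map v (delta_mx 0 i) = v i.
Proof.
rewrite /= (bigD1 i) //= mxE !eqxx scale1r big1 ?addr0 // => j ji.
by rewrite mxE (negPf ji) andbF scale0r.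
Qed.

Lemma free_ext n M (f g : {linear free_mod n -> M}) :
  (forall i, f (delta_mx 0 i) = g (delta_mx 0 i)) -> f =1 g.
Proof.
move=> fg x; rewrite [x]row_sum_delta !linear_sum; apply: eq_bigr => i _.
by rewrite !linearZ /= fg.
Qed.

Lemma free_projective n : projective (free_mod n).
Proof.
move=> X Y p f ps; have [s sK] := choice (fun i => ps (f (delta_mx 0 i))).
exists (free_map s); apply: (@free_ext n Y (p \o free_map s)) => i.
exact: etrans (congr1 p (free_map_delta s i)) (sK i).
Qed.

Lemma regular_projective : projective (regmod R).
Proof.
move=> X Y p f ps; have [x xE] := ps (f (1 : R)).
have lh : linear (fun r : regmod R => (r : R) *: x).
  by move=> a r s; rewrite scalerDl -scalerA.
exists (lin_of lh) => r /=; rewrite linearZ /= xE -linearZ; congr (f _).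
exact: mulr1.
Qed.

Lemma free_cover M : exists n (p : {linear free_mod n -> M}),
  forall y, exists x, p x = y.
Proof.
have [n [v vP]] := fgmodP M; exists n, (free_map v) => y.
by have [c ->] := vP y; exists (\row_i c i); apply: eq_bigr => i _; rewrite mxE.
Qed.

Lemma projective_cover M : exists K P, projective P /\ is_ses K P M.
Proof.
have [n [p ps]] := free_cover M; have [K [i ip]] := kernel_ses ps.
by exists K, (free_mod n); split; [apply: free_projective|exists i, p].
Qed.

Lemma projective_retract P Q (i : {linear P -> Q}) (r : {linear Q -> P}) :
  (forall x, r (i x) = x) -> projective Q -> projective P.
Proof.
move=> riK pQ X Y p f ps; have [h hE] := pQ X Y p (f \o r) ps.
by exists (h \o i) => x; have := hE (i x); rewrite /= riK.
Qed.

Lemma projective_free_retract P : projective P ->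
  exists n (i : {linear P -> free_mod n}) (r : {linear free_mod n -> P}),
    forall x, r (i x) = x.
Proof.
move=> pP; have [n [p ps]] := free_cover P; exists n.
by have [h hE] := pP _ _ p (lin_id P) ps; exists h, p.
Qed.

Lemma projective_prod P Q : projective P -> projective Q -> projective (fgprod P Q).
Proof.
move=> pP pQ X Y p f ps.
have [h hE] := pP _ _ p (f \o inll P Q) ps;
  have [g gE] := pQ _ _ p (f \o inrl P Q) ps.
exists (copairl h g) => -[x y]; have /= hx := hE x; have /= gy := gE y.
by rewrite /= linearD /= hx gy -linearD; congr (f _); congr (_, _);
  rewrite /= ?addr0 ?add0r.
Qed.

Lemma projective_zero P : (forall x : P, x = 0) -> projective P.
Proof. by move=> P0 X Y p f _; exists (lin0 P X) => x; rewrite (P0 x) !linear0. Qed.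

Lemma zero_mod : exists Z : fgmod R, forall x : Z, x = 0.
Proof. by exists (free_mod 0) => x; apply/rowP => -[]. Qed.

Lemma bijective_lin_inv X Y (f : {linear X -> Y}) :
    injective f -> (forall y, exists x, f x = y) ->
  exists g : {linear Y -> X}, cancel f g /\ cancel g f.
Proof.
move=> fi fs; have [g gK] := lift_inj (f := lin_id Y) fi fs; exists g; split=> //.
by move=> x; apply: fi; rewrite gK.
Qed.

Lemma isomorphicP X Y : isomorphic X Y <->
  exists (f : {linear X -> Y}) (g : {linear Y -> X}), cancel f g /\ cancel g f.
Proof.
split=> [[f [g fK gK]]|[f [g [fK gK]]]]; last by exists f, g.
have fs y : exists x, f x = y by exists (g y); rewrite gK.
by have [h hK] := bijective_lin_inv (can_inj fK) fs; exists f, h.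
Qed.

Lemma iso_sym X Y : isomorphic X Y -> isomorphic Y X.
Proof. by move=> /isomorphicP[f [g [fK gK]]]; apply/isomorphicP; exists g, f. Qed.

Lemma iso_trans X Y Z : isomorphic X Y -> isomorphic Y Z -> isomorphic X Z.
Proof. by move=> [f fb] [g gb]; exists (g \o f); exact: bij_comp. Qed.

Lemma inj_surj_iso X Y (f : {linear X -> Y}) :
  injective f -> (forall y, exists x, f x = y) -> isomorphic X Y.
Proof.
by move=> fi fs; have [g [fK gK]] := bijective_lin_inv fi fs; exists f; exists g.
Qed.

Lemma is_ses_iso X Y Z X' Y' Z' : isomorphic X' X -> isomorphic Y Y' ->
  isomorphic Z Z' -> is_ses X Y Z -> is_ses X' Y' Z'.
Proof.
move=> /isomorphicP[a [a' [aK aK']]] /isomorphicP[b [b' [bK bK']]].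
move=> /isomorphicP[c [c' [cK cK']]] [f [g [fi fg gs]]].
exists (b \o f \o a), (c \o g \o b'); split=> [||z] /=.
- by move=> x y /(can_inj bK)/fi/(can_inj aK).
- move=> y /=; split=> [|[x <-]].
    move=> /(inj0 (can_inj cK))/fg[x xE]; exists (a' x).
    by rewrite /= aK' xE bK'.
  by rewrite /= bK (fg _).2 ?linear0 //; exists (a x).
- by have [y yE] := gs (c' z); exists (b y); rewrite bK yE cK'.
Qed.

Lemma iso_refl X : isomorphic X X.
Proof. by exists (lin_id X); exists id. Qed.

Lemma iso_prod X Y X' Y' : isomorphic X X' -> isomorphic Y Y' ->
  isomorphic (fgprod X Y) (fgprod X' Y').
Proof.
move=> [f [f' fK fK']] [g [g' gK gK']]; exists (prodl f g).
exists (fun z : fgprod X' Y' => (f' z.1, g' z.2) : fgprod X Y) => -[x y] /=.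
  by rewrite fK gK.
by rewrite fK' gK'.
Qed.

Lemma iso_prodC X Y : isomorphic (fgprod X Y) (fgprod Y X).
Proof.
exists (pairl (@sndl X Y) (@fstl X Y)).
by exists (fun z : fgprod Y X => (z.2, z.1) : fgprod X Y) => -[].
Qed.

Lemma iso_prodA X Y Z : isomorphic (fgprod X (fgprod Y Z)) (fgprod (fgprod X Y) Z).
Proof.
exists (pairl (pairl (@fstl _ _) (@fstl _ _ \o @sndl X (fgprod Y Z)))
              (@sndl _ _ \o @sndl X (fgprod Y Z))).
exists (fun z : fgprod (fgprod X Y) Z =>
  (z.1.1, (z.1.2, z.2)) : fgprod X (fgprod Y Z)).
  by move=> [x [y z]].
by move=> [[x y] z].
Qed.

Lemma ses_section_iso X Y Z (f : {linear X -> Y}) (g : {linear Y -> Z})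
    (s : {linear Z -> Y}) :
  ses f g -> (forall z, g (s z) = z) -> isomorphic (fgprod X Z) Y.
Proof.
move=> sfg sK; case: (sfg) => fi fg gs; apply: (@inj_surj_iso _ _ (copairl f s)).
  apply: lin_inj => -[x z] /= xz.
  have z0 : z = 0.
    have /(congr1 g) := xz.
    by rewrite linearD /= (ses_comp0 _ sfg) add0r sK linear0.
  by move: xz; rewrite z0 linear0 addr0 => /(inj0 fi) ->.
move=> y; have /fg[x xE] : g (y - s (g y)) = 0 by rewrite linearB /= sK subrr.
by exists (x, g y); rewrite /= xE subrK.
Qed.

Lemma ses_projective_section X Y P (f : {linear X -> Y}) (g : {linear Y -> P}) :
  projective P -> ses f g -> exists s : {linear P -> Y}, forall z, g (s z) = z.
Proof. by move=> pP [_ _ gs]; have [s sE] := pP _ _ g (lin_id P) gs; exists s. Qed.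

Lemma ses_section_retraction X Y Z (f : {linear X -> Y}) (g : {linear Y -> Z})
    (s : {linear Z -> Y}) :
  ses f g -> (forall z, g (s z) = z) ->
  exists r : {linear Y -> X}, forall x, r (f x) = x.
Proof.
move=> sfg sK; case: (sfg) => fi fg gs.
have [|r rE] := @lift_inj _ _ _ f (lin_id Y \- (s \o g)) fi.
  by move=> y; apply/fg; rewrite linearB /= sK subrr.
by exists r => x; apply: fi; rewrite rE /= (ses_comp0 _ sfg) linear0 subr0.
Qed.

(** Both projections of the pullback of the two covers are surjections onto projectives, with
    kernels [K] and [K']; splitting each of them computes the pullback in two ways. *)
Lemma schanuel K K' P P' M : projective P -> projective P' ->
  is_ses K P M -> is_ses K' P' M -> isomorphic (fgprod K P') (fgprod K' P).
Proof.
move=> pP pP' [f [g fg]] [f' [g' fg']];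
  have [E [j [p [q [jp pqE qj]]]]] := pullback_ses g' fg.
have [s sK] := ses_projective_section pP' jp.
apply: iso_trans (ses_section_iso jp sK) _; apply: iso_sym.
case: (fg) => fi fgE gs; case: (fg') => fi' fgE' gs'; case: (jp) => ji jpE ps.
(* [pullback_ses] describes the kernel of [p]; surjectivity of [q] and its kernel [K'] are worked
   out by hand. *)
have qs y : exists e, q e = y.
  have [y' y'E] := gs' (g y); have [e eE] := ps y'.
  have /fgE[u uE] : g (y - q e) = 0 by rewrite linearB /= -pqE eE y'E subrr.
  by exists (e + j u); rewrite linearD /= qj uE addrC subrK.
have qi e : q e = 0 -> p e = 0 -> e = 0.
  by move=> q0 /jpE[u ue]; move: q0; rewrite -ue qj => /(inj0 fi) ->;
    rewrite linear0.
have ex_e u : exists e, pairl p q e = pairl f' (lin0 K' P) u.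
  have [e eE] := ps (f' u).
  have /fgE[v vE] : g (q e) = 0 by rewrite -pqE eE (ses_comp0 _ fg').
  exists (e - j v); congr (_, _).
    by rewrite linearB /= eE; rewrite (jpE _).2 ?subr0 //; exists v.
  by rewrite linearB /= qj vE subrr.
have [|j' j'E] := lift_inj _ ex_e; first by apply: lin_inj => e /= [p0 q0];
  apply: qi.
have jq : ses j' q.
  split=> [|e|//].
    by apply: lin_inj => u; have [p1 _] := j'E u => u0; apply: (inj0 fi');
      rewrite -p1 u0 linear0.
  split=> [q0|[u <-]]; last by have [_ ->] := j'E u.
  have /fgE'[u uE] : g' (p e) = 0 by rewrite pqE q0 linear0.
  exists u; apply/eqP; rewrite -subr_eq0; apply/eqP/qi; rewrite linearB /=.
    by have [_ ->] := j'E u; rewrite q0 subr0.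
  by have [-> _] := j'E u; rewrite uE subrr.
have [t tK] := ses_projective_section pP jq; exact: ses_section_iso jq tK.
Qed.

End Exactness.

(** * Coresolutions by projectives *)

Section Coresolutions.
Variables (k : fieldType) (R : falgType k).
Implicit Types (E K L M N P Q X Y Z : fgmod R) (C : fgmod R -> Prop).

Definition coresolving C : Prop := forall M, C M ->
  exists P N : fgmod R, [/\ projective P, is_ses M P N & C N].

(** The greatest coresolving class, a coinductive encoding of infinite coresolutions: membership is
    shown by exhibiting an invariant class instead of a sequence. *)
Definition coresolved M : Prop := exists C, coresolving C /\ C M.

Lemma coresolved_coresolving : coresolving coresolved.
Proof.
move=> M [C [cC /cC[P [N [pP s CN]]]]]; exists P, N; split=> //.
by exists C.
Qed.

(** Vanishing of Ext^1(M, N), tested on all short exact sequences ending in [M]. *)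
Definition ext1_zero M N : Prop :=
  forall X Y (f : {linear X -> Y}) (g : {linear Y -> M}), ses f g ->
  forall h : {linear X -> N}, exists h' : {linear Y -> N}, forall x, h' (f x) = h x.

Lemma ext1_zero_projective P N : projective P -> ext1_zero P N.
Proof.
move=> pP X Y f g fg h; have [s sK] := ses_projective_section pP fg.
have [r rK] := ses_section_retraction fg sK.
by exists (h \o r) => x /=; rewrite rK.
Qed.

(** A form of finite injective dimension in which the middle term may itself be of this kind rather
    than injective. This lets coresolutions of X and Y be combined into one for X ⊗ Y one variable
    at a time. *)
Inductive fin_inj : fgmod R -> Prop :=
| fin_inj0 N : injective_mod N -> fin_inj N
| fin_injS N N' N'' : is_ses N N' N'' -> fin_inj N' -> fin_inj N'' -> fin_inj N.

Lemma ext1_zero_section M N E (f : {linear N -> E}) (g : {linear E -> M}) :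
  ext1_zero M N -> ses f g -> exists s : {linear M -> E}, forall x, g (s x) = x.
Proof.
move=> e0 fg; have [r rK] := e0 _ _ _ _ fg (lin_id N); case: (fg) => fi fgE gs.
have [|s sE] := @factor_surj _ _ _ _ _ g (lin_id E \- (f \o r)) gs.
  by move=> x /fgE[u <-] /=; rewrite rK subrr.
exists s => x; have [y <-] := gs x.
by rewrite sE linearB /= (ses_comp0 _ fg) subr0.
Qed.

(* Ext^1(M, N) = Ext^1(M', N'') up to the vanishing of Ext^1(P, -) and of
   Ext^1(M, N'), so the vanishing propagates along a finite injective
   coresolution of N. *)
Lemma ext1_zero_shift M P M' N N' N'' : is_ses M P M' -> is_ses N N' N'' ->
  ext1_zero P N -> ext1_zero M N' -> ext1_zero M' N'' -> ext1_zero M N.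
Proof.
move=> [a [b ab]] [i [q iq]] ePN eMN' eMN'' X Y f g fg h.
case: (ab) => ai abE bs; case: (iq) => ii iqE qs; case: (fg) => fi fgE gs.
have [H HE] := eMN' _ _ _ _ fg (i \o h).
have [|t tE] := @factor_surj _ _ _ _ _ g (q \o H) gs.
  by move=> y /fgE[x <-] /=; rewrite HE /= (ses_comp0 _ iq).
have [T TE] := eMN'' _ _ _ _ ab t.
(* The pullback of [q] along [T] is an extension of [P] by [N], so it splits and [T] lifts to [N'].
   Correcting [H] by this lift makes it land in the kernel [N] of [q] and does not change it on
   [X]. *)
have [E [j [p [r [jp prE rj]]]]] := pullback_ses T iq.
have [s sK] := ext1_zero_section ePN jp.
have LE y : q (r (s (a (g y)))) = q (H y) by rewrite -prE sK TE tE.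
have [|h' hE] := @lift_inj _ _ _ _ _ i (H \- (r \o s \o a \o g)) ii.
  by move=> y; apply/iqE; rewrite linearB /= LE subrr.
exists h' => x; apply: ii.
by rewrite hE /= (ses_comp0 _ fg) !linear0 addr0 HE.
Qed.

(** The middle terms are asked to be acyclic against all of [fin_inj] instead of projective, because
    for X ⊗ Y they will be X ⊗ Q with Q projective. *)
Lemma coresolving_ext1_zero C :
    (forall M, C M -> exists P M', [/\ is_ses M P M', C M' &
       forall N, fin_inj N -> ext1_zero P N]) ->
  forall N, fin_inj N -> forall M, C M -> ext1_zero M N.
Proof.
move=> Cs N; elim=> [{}N iN|{}N N' N'' s fN' IH1 fN'' IH2] M CM.
  by move=> X Y f g [fi _ _] h; apply: iN.
have [P [M' [s' CM' eP]]] := Cs M CM.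
by apply: (ext1_zero_shift s' s); [apply/eP/(fin_injS s)|apply: IH1|apply: IH2].
Qed.

Lemma coresolved_ext1_zero N M : fin_inj N -> coresolved M -> ext1_zero M N.
Proof.
move=> fN cM; apply: (coresolving_ext1_zero _ fN cM) => L.
move=> /coresolved_coresolving[P [L' [pP s cL']]].
by exists P, L'; split=> // N' _; exact: ext1_zero_projective.
Qed.

Lemma injective_zero N : (forall x : N, x = 0) -> injective_mod N.
Proof.
by move=> N0 X Y i f _; exists (lin0 Y N) => x; rewrite (N0 (f x)).
Qed.

Lemma ses_image X Y Z (f : {linear X -> Y}) (g : {linear Y -> Z}) M
    (e : {linear M -> X}) : injective e -> exact e f -> exact f g ->
  exists K (p : {linear X -> K}) (i : {linear K -> Y}),
    [/\ ses e p, injective i, exact i g & forall x, i (p x) = f x].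
Proof.
move=> ei ef fg; have [K [p [i [ps ii ipE]]]] := image_factor f.
exists K, p, i; split=> //.
  split=> // x; split=> [px|/ef fx]; first by apply/ef; rewrite -ipE px linear0.
  by apply: (inj0 ii); rewrite ipE.
move=> y; split=> [/fg[x <-]|[u <-]]; first by exists (p x); rewrite ipE.
by have [x <-] := ps u; rewrite ipE; apply/fg; exists x.
Qed.

(** The invariant class consists of the kernels of all differentials of the complete resolution. *)
Lemma gproj_coresolved M : gproj M -> coresolved M.
Proof.
move=> [P [d [pP dE _ [e [ei eE]]]]].
exists (fun K => exists i (j : {linear K -> P i}), injective j /\ exact j (d i)).
split; last by exists 1, e.
move=> K [i [j [ji jE]]]; have [L [p [l [jp li lE _]]]] := ses_image ji jE (dE i).
exists (P i), L; split=> //; first by exists j, p.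
by exists (i + 1), l.
Qed.

Lemma coresolved_sequence M : coresolved M ->
  exists Z : nat -> fgmod R, [/\ Z 0%N = M, forall n, coresolved (Z n) &
    forall n, exists P, projective P /\ is_ses (Z n) P (Z n.+1)].
Proof.
move=> cM.
pose S := {N : fgmod R | coresolved N}.
have /choice[next nextE] : forall x : S, exists y : S,
    exists P, projective P /\ is_ses (sval x) P (sval y).
  move=> [N cN]; have [P [N' [pP s cN']]] := coresolved_coresolving cN.
  by exists (exist _ N' cN'), P.
exists (fun n => sval (iter n next (exist _ M cM))); split=> // n.
by case: (iter n next _).
Qed.

Lemma syzygy_sequence M : exists Z : nat -> fgmod R, Z 0%N = M /\
  forall n, exists P, projective P /\ is_ses (Z n.+1) P (Z n).
Proof.
have [syz syzE] := choice (@projective_cover _ R).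
by exists (fun n => iter n syz M); split=> // n; exact: syzE.
Qed.

(** Kept in [Type], so that sequences chosen for all integers can be used as functions of the
    index. *)
Record projective_ses X Z := ProjectiveSes {
  pses_mid : fgmod R;
  pses_in : {linear X -> pses_mid};
  pses_out : {linear pses_mid -> Z};
  pses_projective : projective pses_mid;
  pses_ses : ses pses_in pses_out }.

Lemma complete_sequence M : coresolved M ->
  exists Z : int -> fgmod R, [/\ Z 1 = M, forall i, coresolved (Z i) &
    forall i, exists P, projective P /\ is_ses (Z i) P (Z (i + 1))].
Proof.
move=> /coresolved_sequence[Zr [Zr0 cZr Zrs]].
have [Zl [Zl0 Zls]] := syzygy_sequence M.
(* The shift puts [M] at index 1, where [gproj] wants it. Since [Zl 0] is [M] as well, index 0 holds
   its first syzygy [Zl 1]. *)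
pose Z (i : int) := match i with
  | Posz n.+1 => Zr n | Posz 0 => Zl 1%N | Negz n => Zl n.+2 end.
have Zs i : exists P, projective P /\ is_ses (Z i) P (Z (i + 1)).
  case: i => [[|n]|[|n]].
  - by have := Zls 0%N; rewrite Zl0 -Zr0.
  - by rewrite -[1]/(1%N%:Z) -PoszD addn1; exact: Zrs.
  - exact: Zls.
  - suff -> : Negz n.+1 + 1 = Negz n by exact: Zls.
    by rewrite !NegzE -addn1 PoszD opprD addrNK.
exists Z; split=> // i.
exists (fun N => exists i, N = Z i); split; last by exists i.
by move=> _ [j ->]; have [P [pP s]] := Zs j; exists P, (Z (j + 1)); split=> //;
  exists (j + 1).
Qed.

Lemma coresolved_gproj M : fin_inj (regmod R) -> coresolved M -> gproj M.
Proof.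
move=> fR /complete_sequence[Z [ZM cZ Zs]]; rewrite -{}ZM.
have {}Zs i : projective_ses (Z i) (Z (i + 1)).
  by have /cid[P [pP /cid[f /cid[g fg]]]] := Zs i; exists P f g.
pose f i := pses_in (Zs i); pose g i := pses_out (Zs i).
have fg i : ses (f i) (g i) := pses_ses (Zs i).
exists (fun i => pses_mid (Zs i)), (fun i => f (i + 1) \o g i); split.
- by move=> i; exact: pses_projective.
- move=> i y /=; case: (fg i) => _ _ gs; case: (fg (i + 1)) => _ fgE _.
  case: (fg (i + 1 + 1)) => fi _ _; split=> [/(inj0 fi)/fgE[z <-]|[x <-]].
    by have [x <-] := gs z; exists x.
  by rewrite (ses_comp0 _ (fg (i + 1))) linear0.
- move=> i h; case: (fg i) => _ _ gs; case: (fg (i + 1)) => _ fgE gs1.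
  split=> [h0|[h' hE] x]; last first.
    by rewrite /= -hE /= (ses_comp0 _ (fg (i + 1))) !linear0.
  have [|t tE] := @factor_surj _ _ _ _ _ (g (i + 1)) h gs1.
    by move=> y /fgE[z <-]; have [x <-] := gs z; exact: h0.
  (* The map has descended to a cosyzygy; it extends to the projective containing that cosyzygy
     because the cokernel, being coresolved, has no Ext^1 with the regular module. *)
  have [h' hE] := coresolved_ext1_zero fR (cZ (i + 1 + 1 + 1)) (fg (i + 1 + 1)) t.
  by exists h' => y /=; rewrite hE tE.
exists (f 1); case: (fg 1) => fi fgE _; split=> // y /=.
case: (fg (1 + 1)) => fi2 _ _; split=> [/(inj0 fi2)/fgE //|/fgE /= ->].
exact: linear0.
Qed.

Lemma gprojE M : fin_inj (regmod R) -> gproj M <-> coresolved M.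
Proof. by move=> fR; split; [exact: gproj_coresolved|exact: coresolved_gproj]. Qed.

End Coresolutions.

(** * Filtrations *)

Section Filtrations.
Variables (k : fieldType) (R : falgType k).
Implicit Types (E K L M N P Q X Y Z : fgmod R) (C D : fgmod R -> Prop).

(** An inductive form of [filt] which grows at the top and speaks of modules rather than predicates
    on a fixed module, so that short exact sequences can be spliced. *)
Inductive filtered C : fgmod R -> Prop :=
| filtered0 X : (forall x : X, x = 0) -> filtered C X
| filteredS X Y Z : filtered C X -> is_ses X Y Z -> C Z -> filtered C Y.

Lemma filtered_iso C X Y : isomorphic X Y -> filtered C X -> filtered C Y.
Proof.
move=> XY fX; case: fX XY => [{}X X0 [f [g fK gK]]|{}X {}X' Z fX s CZ XY].
  by apply: filtered0 => y; rewrite -[y]gK (X0 (g y)) linear0.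
by apply: (filteredS fX _ CZ); apply: is_ses_iso s;
  [exact: iso_refl|done|exact: iso_refl].
Qed.

Lemma ses_zero_l X Y : (forall x : X, x = 0) -> is_ses X Y Y.
Proof.
move=> X0; exists (lin0 X Y), (lin_id Y); split=> [x y _|y|y]; last by exists y.
  by rewrite (X0 x) (X0 y).
by split=> [y0|[x <-] //]; exists 0.
Qed.

Lemma ses_zero_r X Z : (forall z : Z, z = 0) -> is_ses X X Z.
Proof.
move=> Z0; exists (lin_id X), (lin0 X Z); split=> [x y //|y|z]; last first.
  by exists 0; rewrite (Z0 z).
by split=> // _; exists y.
Qed.

Lemma filtered1 C X : C X -> filtered C X.
Proof.
have [Z Z0] := zero_mod R; move=> CX.
exact: filteredS (filtered0 C Z0) (ses_zero_l X Z0) CX.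
Qed.

Lemma ses_zero_r_iso X Y Z : is_ses X Y Z -> (forall z : Z, z = 0) ->
  isomorphic X Y.
Proof.
move=> [f [g [fi fg gs]]] Z0; apply: inj_surj_iso fi _ => y.
by apply/fg; rewrite (Z0 (g y)).
Qed.

(** [Y'] is the preimage in [Y] of the submodule [Z'] of [Z]. *)
Lemma ses_pullback X Y Z Z' Z'' : is_ses X Y Z -> is_ses Z' Z Z'' ->
  exists Y', is_ses X Y' Z' /\ is_ses Y' Y Z''.
Proof.
move=> [f [g fg]] [i [q iq]].
have [Y' [j [p [r [jp ipE rj]]]]] := pullback_ses i fg; exists Y'.
case: (fg) => fi fgE gs; case: (iq) => ii iqE qs; case: (jp) => ji jpE ps.
split; first by exists j, p.
exists r, (q \o g); split.
- apply: lin_inj => e re; have pe : p e = 0.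
    by apply: (inj0 ii); rewrite ipE re linear0.
  by have /jpE[u ue] := pe; move: re; rewrite -ue rj => /(inj0 fi) ->;
    exact: linear0.
- move=> y /=; split=> [/iqE[u uE]|[e <-]]; last by rewrite -ipE (ses_comp0 _ iq).
  have [e eE] := ps u.
  have /fgE[x xE] : g (y - r e) = 0 by rewrite linearB /= -ipE eE uE subrr.
  by exists (e + j x); rewrite linearD /= rj xE addrC subrK.
- by move=> z; have [u <-] := qs z; have [y <-] := gs u; exists y.
Qed.

(** The third isomorphism theorem: for X ⊂ Y ⊂ W, the term [C] is W/X, which contains Y/X with
    quotient W/Y. *)
Lemma ses_pushout X Y Z W V : is_ses X Y Z -> is_ses Y W V ->
  exists C : fgmod R, is_ses X W C /\ is_ses Z C V.
Proof.
move=> [f [g fg]] [i [q iq]]; case: (fg) => fi fgE gs; case: (iq) => ii iqE qs.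
have ifi : injective (i \o f) by apply: inj_comp.
have [C [c ic]] := cokernel_ses ifi; case: (ic) => _ icE cs.
exists C; split; first by exists (i \o f), c.
have [|a aE] := @factor_surj _ _ _ _ _ g (c \o i) gs.
  by move=> y /fgE[x <-] /=; apply/icE; exists x.
have [|b bE] := @factor_surj _ _ _ _ _ c q cs.
  by move=> w /icE[x <-]; rewrite /= (ses_comp0 _ iq).
exists a, b; split.
- apply: lin_inj => z; have [y <-] := gs z; rewrite aE => /icE[x /= /ii <-].
  exact: ses_comp0 fg.
- move=> v; have [w <-] := cs v; rewrite bE; split=> [/iqE[y <-]|[z]].
    by exists (g y); rewrite aE.
  have [y <-] := gs z; rewrite aE /= => /eqP;
    rewrite -subr_eq0 -linearB => /eqP/icE[x xE].
  have {}xE : i (f x) = i y - w := xE.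
  by apply/iqE; exists (y - f x); rewrite linearB xE opprB addrC subrK.
- by move=> v; have [w <-] := qs v; exists (c w); rewrite bE.
Qed.

Lemma filtered_ext C X Y Z : is_ses X Y Z -> filtered C X -> filtered C Z ->
  filtered C Y.
Proof.
move=> s fX fZ; elim: fZ X Y s fX => [{}Z Z0|Z' {}Z Z'' _ IH s' CZ] X Y s fX.
  exact: filtered_iso (ses_zero_r_iso s Z0) fX.
have [Y' [s1 s2]] := ses_pullback s s'.
exact: filteredS (IH _ _ s1 fX) s2 CZ.
Qed.

Lemma filtered_prod C X Y : filtered C X -> filtered C Y -> filtered C (fgprod X Y).
Proof.
by move=> fX fY; apply: filtered_ext fX fY; exists (inll X Y), (@sndl _ _ X Y);
  exact: ses_split.
Qed.

Lemma sub_filtered C D X : (forall Y, C Y -> filtered D Y) -> filtered C X ->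
  filtered D X.
Proof.
move=> CD; elim=> [{}X X0|{}X Y Z _ fX s CZ]; first exact: filtered0.
exact: filtered_ext s fX (CD _ CZ).
Qed.

Lemma filt_filtered C X : filt C X -> filtered C X.
Proof.
move=> [m [F [Fc F0 Fm FS]]].
(* The terms of the filtration are mere predicates on [X], so the induction ranges over all modules
   [K] embedded with image [F i]. *)
suff H i : (i <= m)%N -> forall K (j : {linear K -> X}), injective j ->
    (forall x, x \in F i <-> exists u, j u = x) -> filtered C K.
  apply: (H m (leqnn m) X (lin_id X)) => // x; rewrite Fm.
  by split=> // _; exists x.
elim: i => [_|i IH lt_im] K j ji jE.
  apply: filtered0 => u; apply: (inj0 ji).
  have : j u \in F 0%N by apply/jE; exists u.
  by rewrite F0 inE => /eqP.
have [L [l [li lE]]] := submodule (Fc i).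
have [sF [Q CQ [p [pl ps pE]]]] := FS i lt_im.
have jF u : j u \in F i.+1 by apply/jE; exists u.
have lpj : linear (fun u => p (j u)).
  by move=> a u v; rewrite linearP pl.
have [|h hE] := @lift_inj _ _ _ _ _ j l ji.
  by move=> z; apply/jE/sF/lE; exists z.
apply: (filteredS (IH (ltnW lt_im) L l li lE) _ CQ); exists h, (lin_of lpj); split.
- by move=> x y xy; apply: li; rewrite -!hE xy.
- move=> u; split=> [/pE -/(_ (jF u))/lE[z zE]|[z <-]].
    by exists z; apply: ji; rewrite hE.
  by apply/pE; rewrite ?jF // hE; apply/lE; exists z.
- by move=> q; have [x /jE[u <-] <-] := ps q; exists u.
Qed.

Lemma filtered_filt C X : filtered C X -> filt C X.
Proof.
elim=> [{}X X0|{}X Y Z _ [m [F [Fc F0 Fm FS]]] [f [g fg]] CZ].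
  exists 0%N, (fun=> predT : {pred X}); split=> // x.
  by rewrite !inE (X0 x) eqxx.
case: (fg) => fi fgE gs.
pose G i := if (i <= m)%N then [pred y : Y | `[< exists2 x, x \in F i & f x = y
  >]] : {pred Y}
  else predT.
exists m.+1, G; split.
- move=> i; rewrite /G; case: leqP => // _; have [Fi0 Fil] := Fc i; split.
    by apply/asboolP; exists 0 => //; rewrite linear0.
  move=> a x y; rewrite !inE => /asboolP[u Fu <-] /asboolP[v Fv <-]; apply/asboolP.
  by exists (a *: u + v); rewrite ?linearP //; exact: Fil.
- move=> y; rewrite /G /= !inE; apply/asboolP/eqP => [[x]|->].
    by rewrite F0 inE => /eqP -> <-; rewrite linear0.
  by exists 0; rewrite ?F0 ?inE ?linear0.
- by rewrite /G ltnn.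
move=> i; rewrite ltnS leq_eqVlt => /predU1P[->|lt_im].
  rewrite /G leqnn ltnn; split=> //; exists Z => //; exists g; split=> //.
  - by move=> a x y _ _; rewrite linearP.
  - by move=> q; have [y yE] := gs q; exists y.
  move=> y _; rewrite fgE inE; split=> [[x xE]|/asboolP[x _ xE]]; last by exists x.
  by apply/asboolP; exists x; rewrite ?Fm.
rewrite /G lt_im (ltnW lt_im); have [sF [Q CQ [p [pl ps pE]]]] := FS i lt_im.
split=> [y|]; first by rewrite !inE => /asboolP[x /sF Fx <-]; apply/asboolP;
  exists x.
(* [subquotient] wants a map defined on all of [Y]; the value 0 outside the image of [f] is
   harmless, since only the restriction to a submodule counts. *)
have [s sK] : exists s : Y -> X, forall x, s (f x) = x.
  have /choice[s sE] : forall y, exists x, (exists x', f x' = y) -> f x = y.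
    move=> y; case: (pselect (exists x', f x' = y)) => [[x' <-]|no];
      first by exists x'.
    by exists 0.
  by exists s => x; apply: fi; apply: sE; exists x.
exists Q => //; exists (p \o s); split=> /=.
- move=> a y y'; rewrite !inE => /asboolP[x Fx <-] /asboolP[x' Fx' <-].
  by rewrite -linearP !sK pl.
- move=> q; have [x Fx <-] := ps q; exists (f x); last by rewrite sK.
  by apply/asboolP; exists x.
move=> y; rewrite !inE => /asboolP[x Fx <-]; rewrite sK pE //.
split=> [Fx'|/asboolP[x' Fx' /fi <-] //].
by apply/asboolP; exists x.
Qed.

Lemma filtE C X : filt C X <-> filtered C X.
Proof. by split; [exact: filt_filtered|exact: filtered_filt]. Qed.

Definition filtered_summand C X : Prop := exists Y, filtered C (fgprod X Y).

Lemma filtbarE C X : filtbar C X <-> filtered_summand C X.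
Proof.
split=> [[Y [Z [/filtE fY YXZ]]]|[Z /filtE fXZ]].
  by exists Z; exact: (@filtered_iso C Y (fgprod X Z) YXZ fY).
by exists (fgprod X Z), Z; split=> //; exact: (iso_refl (fgprod X Z)).
Qed.

Lemma filtered_summand_ext C X Y Z : is_ses X Y Z ->
  filtered_summand C X -> filtered_summand C Z -> filtered_summand C Y.
Proof.
move=> s [X' fX] [Z' fZ]; exists (fgprod X' Z').
apply: filtered_ext fX fZ; case: s => f [g fg].
apply: is_ses_iso (iso_refl _) _ (iso_refl _) (is_ses_prod (ex_intro _ f
  (ex_intro _ g fg)) _).
  exact: iso_refl.
by exists (inll X' Z'), (@sndl _ _ X' Z'); exact: ses_split.
Qed.

Lemma filtered_summand_iso C X Y : isomorphic X Y ->
  filtered_summand C X -> filtered_summand C Y.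
Proof.
move=> XY [X' fX]; exists X'; apply: filtered_iso fX.
exact: iso_prod XY (iso_refl _).
Qed.

Lemma filtered_summand_l C X Y : filtered_summand C (fgprod X Y) ->
  filtered_summand C X.
Proof.
by move=> [Z fZ]; exists (fgprod Y Z); apply: filtered_iso fZ;
  exact/iso_sym/iso_prodA.
Qed.

Lemma filtered_summandW C X : filtered C X -> filtered_summand C X.
Proof.
have [Z Z0] := zero_mod R; move=> fX; exists Z.
by apply: filtered_prod fX (filtered0 _ Z0).
Qed.

Lemma filtered_summand_retract C X Y (i : {linear X -> Y}) (r : {linear Y -> X}) :
  (forall x, r (i x) = x) -> filtered C Y -> filtered_summand C X.
Proof.
move=> riK fY; have [Z [g ig]] := cokernel_ses (can_inj riK).
exists Z; apply: filtered_iso fY; apply: iso_sym.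
case: (ig) => ii iE gs.
have [|s sE] := @factor_surj _ _ _ _ _ g (lin_id Y \- (i \o r)) gs.
  by move=> y /iE[u <-] /=; rewrite riK subrr.
apply: (ses_section_iso ig (s := s)) => z; have [y <-] := gs z.
by rewrite sE linearB /= (ses_comp0 _ ig) subr0.
Qed.

Lemma filtered_summand_projective C P : filtered C (regmod R) ->
  projective P -> filtered_summand C P.
Proof.
move=> fR /projective_free_retract[n [i [r riK]]].
suff fF : filtered C (free_mod R n) by exact: filtered_summand_retract riK fF.
elim: n {i r riK} => [|n IH]; first by apply: filtered0 => x; apply/rowP => -[].
have lf : linear (fun x : free_mod R n.+1 =>
    (x 0 ord0, \row_(i < n) x 0 (lift ord0 i)) : fgprod (regmod R) (free_mod R n)).
  move=> a x y; congr (_, _); first by rewrite !mxE.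
  by apply/rowP => i; rewrite !mxE.
apply: filtered_iso (filtered_prod fR IH); apply: iso_sym.
apply: (inj_surj_iso (f := lin_of lf)).
  apply: lin_inj => x [x0 xS]; apply/rowP => i; rewrite mxE.
  case: (unliftP ord0 i) => [j|] -> //.
  by move: xS => /rowP/(_ j); rewrite !mxE.
move=> [a v]; exists (\row_i if unlift ord0 i is Some j then v 0 j else a).
congr (_, _); first by rewrite mxE unlift_none.
by apply/rowP => j; rewrite !mxE liftK.
Qed.

End Filtrations.

(** * Gorenstein dimension *)

Section GorensteinDimension.
Variables (k : fieldType) (R : falgType k).
Implicit Types (E K L M N P Q X Y Z : fgmod R) (C D : fgmod R -> Prop).

(** [P1] is not assumed injective: the vanishing of Ext^1(M2, P1) is what extends the embedding of
    [M1] to [M]. *)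
Lemma horseshoe_inj M1 M M2 P1 N1 P2 N2 : is_ses M1 M M2 -> is_ses M1 P1 N1 ->
    is_ses M2 P2 N2 -> ext1_zero M2 P1 ->
  exists N, is_ses M (fgprod P1 P2) N /\ is_ses N1 N N2.
Proof.
move=> [f [g fg]] [i1 [p1 ip1]] [i2 [p2 ip2]] e0.
have [a aE] := e0 _ _ _ _ fg i1; pose i := pairl a (i2 \o g).
case: (fg) => fi fgE gs; case: (ip1) => ii1 ip1E ps1; case: (ip2) => ii2 ip2E ps2.
have ii : injective i.
  apply: lin_inj => x [ax /(inj0 ii2)/fgE[u uE]].
  by move: ax; rewrite -uE aE => /(inj0 ii1) ->; exact: linear0.
have [N [p ip]] := cokernel_ses ii; case: (ip) => _ ipE ps.
exists N; split; first by exists i, p.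
have [|b bE] := @factor_surj _ _ _ _ _ p1 (p \o inll P1 P2) ps1.
  move=> y /ip1E[u <-] /=; apply/ipE; exists (f u).
  by rewrite /= aE (ses_comp0 _ fg) linear0.
have [|c cE] := @factor_surj _ _ _ _ _ p (p2 \o @sndl _ _ P1 P2) ps.
  by move=> y /ipE[u <-] /=; rewrite (ses_comp0 _ ip2).
exists b, c; split.
- apply: lin_inj => y; have [z <-] := ps1 y; rewrite bE /= => /ipE[m [am]].
  move=> /(inj0 ii2)/fgE[u uE]; apply/ip1E; exists u.
  by rewrite -am -uE aE.
- move=> y; have [[z1 z2] <-] := ps y; rewrite cE /=; split=> [/ip2E[m mE]|[w]].
    have [x xE] := gs m; exists (p1 (z1 - a x)); rewrite bE /=.
    rewrite -[RHS]subr0 -(ses_comp0 x ip) -linearB; congr (p _).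
    by congr (_, _); rewrite //= xE mE subrr.
  have [z <-] := ps1 w; rewrite bE /= => /eqP;
    rewrite -subr_eq0 -linearB => /eqP/ipE[m [_ mE]].
  by move: mE; rewrite /= sub0r => /(congr1 -%R); rewrite opprK => <-;
    rewrite linearN /= (ses_comp0 _ ip2) oppr0.
- by move=> y; have [z <-] := ps2 y; exists (p (0, z)); rewrite cE.
Qed.

Lemma horseshoe_proj M1 M M2 P1 N1 P2 N2 : is_ses M1 M M2 -> is_ses N1 P1 M1 ->
    is_ses N2 P2 M2 -> projective P2 ->
  exists N, is_ses N (fgprod P1 P2) M /\ is_ses N1 N N2.
Proof.
move=> [f [g fg]] [i1 [p1 ip1]] [i2 [p2 ip2]] pP2.
case: (fg) => fi fgE gs; case: (ip1) => ii1 ip1E ps1; case: (ip2) => ii2 ip2E ps2.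
have [a aE] := pP2 _ _ g p2 gs; pose p := copairl (f \o p1) a.
have gpE z : g (p z) = p2 z.2 by rewrite linearD /= (ses_comp0 _ fg) add0r;
  exact: aE.
have ps y : exists x, p x = y.
  have [z2 z2E] := ps2 (g y).
  have /fgE[x xE] : g (y - a z2) = 0 by rewrite linearB /= -z2E -aE subrr.
  by have [z1 z1E] := ps1 x; exists (z1, z2); rewrite /= z1E xE subrK.
have [N [i ip]] := kernel_ses ps; case: (ip) => ii ipE _.
exists N; split; first by exists i, p.
have [|b bE] := @lift_inj _ _ _ _ _ i (inll P1 P2 \o i1) ii.
  by move=> u; apply/ipE; rewrite /= (ses_comp0 _ ip1) !linear0 addr0.
have [|c cE] := @lift_inj _ _ _ _ _ i2 (@sndl _ _ P1 P2 \o i) ii2.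
  by move=> u; apply/ip2E; rewrite -gpE (ses_comp0 _ ip) linear0.
exists b, c; split.
- by apply: lin_inj => u bu; have := bE u;
  rewrite bu linear0 => -[/esym/(inj0 ii1)].
- move=> n; split=> [cn|[u <-]]; last by apply: (inj0 ii2); rewrite cE /= bE.
  have /= n2 : (i n).2 = 0 by rewrite -[LHS](cE n) cn linear0.
  have : p (i n) = 0 by exact: ses_comp0 ip.
  rewrite /= n2 linear0 addr0 => /(inj0 fi)/ip1E[u uE].
  by exists u; apply: ii; rewrite bE /= uE; case: (i n) n2 => ? ? /= ->.
- move=> n2; have : g (a (i2 n2)) = 0 by rewrite [LHS]aE (ses_comp0 _ ip2).
  move=> /fgE[m mE]; have [z zE] := ps1 m.
  have /ipE[n nE] : p (- z, i2 n2) = 0 by rewrite /= !linearN /= zE mE addNr.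
  by exists n; apply: ii2; rewrite cE /= nE.
Qed.

Lemma ext1_zero_regular M P : ext1_zero M (regmod R) -> projective P ->
  ext1_zero M P.
Proof.
move=> e0 /projective_free_retract[n [i [r riK]]] X Y f g fg h.
have lc j : linear (fun v : free_mod R n => v 0 j : regmod R).
  by move=> a u v; rewrite !mxE.
have /choice[t tE] j := e0 _ _ _ _ fg (lin_of (lc j) \o i \o h).
have lt : linear (fun y => \row_j t j y : free_mod R n).
  by move=> a u v; apply/rowP => j; rewrite !mxE linearP.
exists (r \o lin_of lt) => x; rewrite -[RHS]riK /=; congr (r _).
by apply/rowP => j; rewrite !mxE tE.
Qed.

(** By the horseshoe, the modules filtered by [C] form a coresolving class. Cokernels are asked to
    be filtered rather than in [C] because the one arising for X ⊗ Y is an extension of two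
    products. *)
Lemma filtered_coresolved C :
    (forall M, C M -> ext1_zero M (regmod R)) ->
    (forall M, C M -> exists P N, [/\ projective P, is_ses M P N & filtered C N]) ->
  forall M, filtered C M -> coresolved M.
Proof.
move=> e0 emb M fM; exists (filtered C); split=> // {fM}M.
elim=> [X X0|X Y Z _ [P1 [N1 [pP1 s1 fN1]]] s /[dup] CZ /emb[P2 [N2 [pP2 s2 fN2]]]].
  exists X, X; split; [exact: projective_zero|exact: ses_zero_l|exact: filtered0].
have [|N [s3 s4]] := horseshoe_inj s s1 s2.
  by apply: ext1_zero_regular pP1; exact: e0.
exists (fgprod P1 P2), N; split=> //; first exact: projective_prod.
exact: filtered_ext s4 fN1 fN2.
Qed.

Lemma coresolved_iso M N : isomorphic M N -> coresolved M -> coresolved N.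
Proof.
move=> MN cM; have [P [N' [pP s cN']]] := coresolved_coresolving cM.
exists (fun X => isomorphic M X \/ coresolved X); split; last by left.
move=> X [MX|cX]; last first.
  have [P' [X' [pP' s' cX']]] := coresolved_coresolving cX.
  by exists P', X'; split=> //; right.
exists P, N'; split=> //; last by right.
by apply: is_ses_iso s; [exact: iso_sym|exact: iso_refl|exact: iso_refl].
Qed.

Lemma coresolved_projective P : projective P -> coresolved P.
Proof.
have [Z Z0] := zero_mod R; have pZ := projective_zero Z0 => pP.
exists (@projective R); split=> // {P pP}P pP; exists P, Z; split=> //.
exact: ses_zero_r.
Qed.

Lemma coresolved_syzygy K P M : projective P -> is_ses K P M -> coresolved M ->
  coresolved K.
Proof.
move=> pP s cM; exists (fun X => X = K \/ coresolved X); split; last by left.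
move=> X [->|/coresolved_coresolving[P' [X' [pP' s' cX']]]].
  by exists P, M; split=> //; right.
by exists P', X'; split=> //; right.
Qed.

Section FiniteInjectiveDimension.
Hypothesis fR : fin_inj (regmod R).

Lemma coresolved_filtered M : filtered (@coresolved _ R) M -> coresolved M.
Proof.
apply: filtered_coresolved => {}M; first exact: coresolved_ext1_zero.
move=> /coresolved_coresolving[P [N [pP s cN]]]; exists P, N; split=> //.
exact: filtered1.
Qed.

Lemma coresolved_ext X Y Z : is_ses X Y Z -> coresolved X -> coresolved Z ->
  coresolved Y.
Proof.
move=> s cX cZ; apply: coresolved_filtered.
by apply: filteredS s cZ; exact: filtered1.
Qed.

(** Let M ⊕ N embed in a projective P with cokernel L, and let K = P/M. Then K is an extension of L
    by N; adding M to the first two terms makes K ⊕ M an extension of L by N ⊕ M, hence coresolved.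
    So K is again a summand of a coresolved module. *)
Lemma coresolved_summand M N : coresolved (fgprod M N) -> coresolved M.
Proof.
move=> cMN; exists (fun X => exists Y, coresolved (fgprod X Y)).
split; last by exists N.
move=> {}M {N cMN}[N cMN].
have [P [L [pP [f [g fg]] cL]]] := coresolved_coresolving cMN.
case: (fg) => fi fgE gs.
have ii : injective (f \o inll M N) by move=> x y /fi [].
have [K [q iq]] := cokernel_ses ii; case: (iq) => _ iqE qs.
exists P, K; split=> //; first by exists (f \o inll M N), q.
exists M; apply: (coresolved_ext (X := fgprod N M) (Z := L)) => //; last first.
  by apply: coresolved_iso cMN; exact: iso_prodC.
have [|h hE] := @factor_surj _ _ _ _ _ q g qs.
  by move=> x /iqE[u <-]; rewrite /= (ses_comp0 _ fg).
exists (prodl (q \o f \o inrl M N) (lin_id M)), (h \o @fstl _ _ K M); split.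
- apply: lin_inj => -[n m] /= [/iqE[u uE] ->].
  by move: uE => /fi[_ <-].
- move=> [x m] /=; have [y <-] := qs x; rewrite hE; split=> [/fgE[[m' n] yE]|].
    exists (n, m); congr (_, _); rewrite /= -yE; apply/eqP.
    rewrite -subr_eq0 -linearB -linearB; apply/eqP/iqE; exists (- m').
    by congr (f _); congr (_, _); rewrite /= ?sub0r ?subrr.
  move=> [[n m'] /= [qE _]];
    have : h (q (f (0, n))) = 0 by rewrite hE (ses_comp0 _ fg).
  by rewrite -[f (0, n)]/((f \o inrl M N) n) /= qE hE.
- by move=> z; have [y <-] := gs z; exists (q y, 0); rewrite /= hE.
Qed.

End FiniteInjectiveDimension.

(** Gorenstein dimension at most n. All choices of projectives are quantified over, so that passing
    to a syzygy is immediate; for the existential form [pd_le] this takes Schanuel. *)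
Fixpoint gdim_le n M : Prop :=
  if n is n'.+1 then forall K P, projective P -> is_ses K P M -> gdim_le n' K
  else coresolved M.

(** The truncated [n.-1] includes n = 0, where a syzygy of a coresolved module is still
    coresolved. *)
Lemma gdim_le_syzygy n K P M :
  projective P -> is_ses K P M -> gdim_le n M -> gdim_le n.-1 K.
Proof.
case: n => [|n] pP s gM; first exact: coresolved_syzygy s gM.
exact: gM s.
Qed.

Definition syzygies_filtered C D : Prop := forall M, C M ->
  exists P K, [/\ projective P, is_ses K P M & filtered D K].

Lemma filtered_syzygy C D : syzygies_filtered C D ->
  syzygies_filtered (filtered C) D.
Proof.
move=> CD M; elim=> [X X0|X Y Z _ [P1 [N1 [pP1 s1 fN1]]] s CZ].
  exists X, X; split; [exact: projective_zero|exact: ses_zero_l|exact: filtered0].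
have [P2 [N2 [pP2 s2 fN2]]] := CD _ CZ.
have [N [s3 s4]] := horseshoe_proj s s1 s2 pP2.
exists (fgprod P1 P2), N; split=> //; first exact: projective_prod.
exact: filtered_ext s4 fN1 fN2.
Qed.

(** M ⊕ N has a filtered syzygy K0. Schanuel compares it with the syzygy K ⊕ L up to projective
    summands, which are harmless since they are summands of filtered modules. *)
Lemma filtered_summand_syzygy C D : syzygies_filtered C D ->
  filtered D (regmod R) ->
  forall K P M, projective P -> is_ses K P M -> filtered_summand C M ->
    filtered_summand D K.
Proof.
move=> CD fR K P M pP s [N /(filtered_syzygy CD)[P0 [K0 [pP0 s0 fK0]]]].
have [L [Q [pQ s']]] := projective_cover N.
have iso := schanuel (projective_prod pP pQ) pP0 (is_ses_prod s s') s0.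
apply: (filtered_summand_l (Y := fgprod L P0)).
apply: filtered_summand_iso (iso_trans (iso_sym iso) (iso_sym (iso_prodA _ _ _))) _.
apply: (filtered_summand_ext (X := K0) (Z := fgprod P Q)).
- by exists (inll _ _), (@sndl _ _ _ _); exact: ses_split.
- exact: filtered_summandW.
- exact: filtered_summand_projective (projective_prod pP pQ).
Qed.

(* M is an n-th syzygy for every n, and each syzygy step lowers the index. *)
Lemma coresolved_filtered_summand (T : nat -> fgmod R -> Prop) :
    (forall n, syzygies_filtered (T n.+1) (T n)) ->
    (forall n, filtered (T n) (regmod R)) ->
    (exists n, forall M, filtered (T n) M) ->
  forall M, coresolved M -> filtered_summand (T 0%N) M.
Proof.
move=> TS TR [n Tn]; have: forall M, coresolved M -> filtered_summand (T n) M.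
  by move=> M _; exact/filtered_summandW/Tn.
elim: n {Tn} => // n IH H; apply: IH => M.
move=> /coresolved_coresolving[P [N [pP s cN]]].
exact: (filtered_summand_syzygy (TS n) (TR n) pP s (H _ cN)).
Qed.

End GorensteinDimension.

(** * Projective dimension and bounds on Gorenstein dimension *)

Section ProjectiveDimension.
Variables (k : fieldType) (R : falgType k).
Implicit Types (E J K L M N P Q X Y Z : fgmod R).

Fixpoint pd_le n M : Prop :=
  if n is n'.+1 then exists K P : fgmod R, [/\ projective P, is_ses K P M & pd_le
    n' K]
  else projective M.

Lemma projective_iso M N : isomorphic M N -> projective M -> projective N.
Proof.
by move=> /iso_sym/isomorphicP[f [g [fK gK]]]; exact: projective_retract fK.
Qed.

Lemma pd_le_iso n M N : isomorphic M N -> pd_le n M -> pd_le n N.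
Proof.
case: n => [|n] MN; first exact: projective_iso.
move=> [K [P [pP s pK]]]; exists K, P; split=> //.
by apply: is_ses_iso s; [exact: iso_refl|exact: iso_refl|].
Qed.

Lemma pd_le_prod n M N : pd_le n M -> pd_le n N -> pd_le n (fgprod M N).
Proof.
elim: n M N => [|n IH] M N /=; first exact: projective_prod.
move=> [K [P [pP s pK]]] [L [Q [pQ s' pL]]]; exists (fgprod K L), (fgprod P Q).
by split; [exact: projective_prod|exact: is_ses_prod|exact: IH].
Qed.

Lemma pd_le_projective n P : projective P -> pd_le n P.
Proof.
elim: n P => // n IH P pP; have [Z Z0] := zero_mod R.
exists Z, P; split=> //; first exact: ses_zero_l.
exact/IH/projective_zero.
Qed.

(** Syzygies of [M] and [N] add up to one of the product; by Schanuel the given syzygy [K] agrees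
    with it up to projectives, and the induction applies to the summand coming from [M]. *)
Lemma pd_le_summand n M N : pd_le n (fgprod M N) -> pd_le n M.
Proof.
elim: n M N => [|n IH] M N.
  by apply: (@projective_retract _ _ _ _ (inll M N) (@fstl _ _ M N)).
move=> [K [P [pP s pK]]].
have [K1 [P1 [pP1 s1]]] := projective_cover M.
have [K2 [P2 [pP2 s2]]] := projective_cover N.
exists K1, P1; split=> //; apply: (IH _ (fgprod K2 P)).
apply: pd_le_iso (iso_sym (iso_prodA _ _ _)) _.
apply: pd_le_iso (schanuel pP (projective_prod pP1 pP2) s (is_ses_prod s1 s2)) _.
by apply: pd_le_prod pK _; exact/pd_le_projective/projective_prod.
Qed.

Lemma pd_le_syzygy n K P M : projective P -> is_ses K P M -> pd_le n.+1 M ->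
  pd_le n K.
Proof.
move=> pP s [K' [P' [pP' s' pK']]]; apply: (pd_le_summand (N := P')).
apply: pd_le_iso (schanuel pP' pP s' s) _.
by apply: pd_le_prod pK' _; exact: pd_le_projective.
Qed.

Fixpoint nth_syzygy n K M : Prop :=
  if n is n'.+1 then exists M' P : fgmod R,
    [/\ projective P, is_ses M' P M & nth_syzygy n' K M']
  else K = M.

(* Horseshoe on a coresolution step M -> J -> C with J of projective dimension
   at most n: the n-th syzygies form one with projective middle term. *)
Lemma nth_syzygy_coresolve n K M J C : nth_syzygy n K M -> is_ses M J C ->
  pd_le n J -> exists P K', [/\ projective P, is_ses K P K' & nth_syzygy n K' C].
Proof.
elim: n M J C => [|n IH] M J C; first by move=> -> s pJ; exists J, C.
move=> [M' [P [pP s KM']]] sMJC pJ.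
have [C' [Q [pQ s']]] := projective_cover C.
have [J' [sJ' s'']] := horseshoe_proj sMJC s s' pQ.
have pJ' := pd_le_syzygy (projective_prod pP pQ) sJ' pJ.
have [P' [K' [pP' sK' K'C']]] := IH _ _ _ KM' s'' pJ'.
by exists P', K'; split=> //; exists C', Q.
Qed.

Lemma nth_syzygy_gdim_le n M :
  (forall K, nth_syzygy n K M -> coresolved K) -> gdim_le n M.
Proof.
elim: n M => [|n IH] M sM; first exact: sM.
by move=> K P pP s; apply: IH => L LK; apply: sM; exists K, P.
Qed.

(** The n-th syzygies of arbitrary modules form a coresolving class, each step coming from an
    embedding into some [J]. *)
Lemma embedding_gdim_le n :
    (forall M, exists J (i : {linear M -> J}), injective i /\ pd_le n J) ->
  forall M, gdim_le n M.
Proof.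
move=> emb M; apply: nth_syzygy_gdim_le => K KM.
exists (fun K => exists M, nth_syzygy n K M); split; last by exists M.
move=> {M KM}K [M KM]; have [J [i [ii pJ]]] := emb M.
have [C [p ip]] := cokernel_ses ii.
have s : is_ses M J C by exists i, p.
have [P [K' [pP s' K'C]]] := nth_syzygy_coresolve KM s pJ.
by exists P, K'; split=> //; exists C.
Qed.

Fixpoint injdim_le n M : Prop :=
  if n is n'.+1 then exists I N : fgmod R,
    [/\ injective_mod I, is_ses M I N & injdim_le n' N]
  else injective_mod M.

Lemma finite_injdim_le M : finite_injdim M -> exists n, injdim_le n M.
Proof.
(* The terms of index above [n] vanish, so a kernel inside [I n.+1] is zero; as a zero module it is
   injective and ends the coresolution after [n.+1] steps. *)
move=> [n [I [d [e [Ii I0 ei ed dd]]]]]; exists n.+1.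
suff H : forall m i K (j : {linear K -> I i}), (n < i + m)%N ->
    injective j -> exact j (d i) -> injdim_le m K.
  by exact: (H n.+1 0%N M e).
elim=> [|m IH] i K j lt_n ji jE.
  apply/injective_zero => x; apply: ji; rewrite linear0.
  by apply: I0; rewrite -[i]addn0.
have [L [p [l [jp li lE _]]]] := ses_image ji jE (dd i).
exists (I i), L; split=> //; first by exists j, p.
by apply: (IH i.+1 L l) => //; rewrite addSnnS.
Qed.

Lemma injdim_le_fin_inj n M : injdim_le n M -> fin_inj M.
Proof.
elim: n M => [|n IH] M; first exact: fin_inj0.
by move=> [I [N [iI s /IH fN]]]; exact: fin_injS s (fin_inj0 iI) fN.
Qed.

End ProjectiveDimension.

Section ConverseAlgebra.
Variables (k : fieldType) (R : falgType k).

HB.instance Definition _ := Vector.copy R^c R.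

Let cscaleAl (c : k) (a b : R^c) : c *: (a * b : R^c) = (c *: a : R^c) * b.
Proof. exact: (@scalerAr k R c b a). Qed.
HB.instance Definition _ := GRing.Lmodule_isLalgebra.Build k R^c cscaleAl.

Let cscaleAr (c : k) (a b : R^c) : c *: (a * b : R^c) = a * (c *: b : R^c).
Proof. exact: (@scalerAl k R c b a). Qed.
HB.instance Definition _ := GRing.Lalgebra_isAlgebra.Build k R^c cscaleAr.

End ConverseAlgebra.

(** * Duality *)

Section Functionals.
Variable k : fieldType.
Implicit Types U V W : vectType k.

(** Used both to extend functionals along injections and to descend them along surjections. The
    pseudo-inverse of [f] recovers [u] modulo the kernel of [f], where [p] vanishes. *)
Lemma functional_extend U V (f : {linear U -> V}) (p : {linear U -> k^o}) :
    (forall u, f u = 0 -> p u = 0) ->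
  exists q : {linear V -> k^o}, forall u, q (f u) = p u.
Proof.
move=> pf; exists (p \o (linfun f)^-1%VF) => u /=.
apply/eqP; rewrite -subr_eq0 -linearB; apply/eqP/pf.
have fu : f u \in limg (linfun f) by rewrite -[f u](lfunE f) memv_img ?memvf.
by rewrite linearB -[X in X - _](lfunE f) (limg_lfunVK fu) subrr.
Qed.

Lemma coord_linear V (i : 'I_(dim V)) : linear (fun v : V => v2r v 0 i : k^o).
Proof. by move=> c u v; rewrite linearP !mxE. Qed.
Definition coordl V i := lin_of (@coord_linear V i).

Lemma functional_separates V (v : V) :
  (forall p : {linear V -> k^o}, p v = 0) -> v = 0.
Proof.
move=> v0; apply: v2r_inj; rewrite linear0; apply/rowP => i.
by rewrite mxE; exact: (v0 (coordl i)).
Qed.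

End Functionals.

Section Duality.
Variables (k : fieldType) (R S : falgType k) (sigma : {linear R -> S}).
Hypothesis sigmaM : forall a b : R, sigma (a * b) = sigma b * sigma a.
Hypothesis sigma1 : sigma 1 = 1.
Implicit Types M N : fgmod S.

Section Object.
Variable M : fgmod S.

Let scale_linear (a : S) : linear (fun m : restr M => a *: (m : M) : restr M).
Proof. by move=> c u v; rewrite scalerDr restrZC. Qed.
Let V : vectType k := 'Hom(restr M, k^o).

Definition dual_act (a : R) (p : 'Hom(restr M, k^o)) : 'Hom(restr M, k^o) :=
  linfun (p \o lin_of (scale_linear (sigma a))).

Lemma dual_actE a p (m : M) : dual_act a p m = p (sigma a *: m : M).
Proof. exact: lfunE. Qed.

Let actl p : linear (dual_act^~ p).
Proof.
move=> c a b; apply/lfunP => m; 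
by rewrite add_lfunE scale_lfunE !dual_actE linearP scalerDl restrZl linearP.
Qed.

Let actr a : linear (dual_act a).
Proof.
by move=> c p q; apply/lfunP => m;
  rewrite add_lfunE scale_lfunE !dual_actE add_lfunE scale_lfunE.
Qed.

Let actM' a b p : dual_act (a * b) p = dual_act a (dual_act b p).
Proof. by apply/lfunP => m; rewrite !dual_actE sigmaM scalerA. Qed.

Let act1' p : dual_act 1 p = p.
Proof. by apply/lfunP => m; rewrite dual_actE sigma1 scale1r. Qed.

(** Hom_k(M, k), with [R] acting through the anti-homomorphism [sigma]. Leaving [sigma] abstract
    lets one construction serve in both directions between a ring and its converse. *)
Definition dual : fgmod R := actfg (Action actl actr actM' act1').

Definition dpair (p : dual) (m : M) : k := (p : 'Hom(restr M, k^o)) m.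

Lemma dpair_scale a (p : dual) m : dpair (a *: p) m = dpair p (sigma a *: m).
Proof. exact: dual_actE. Qed.

Lemma dpair_linear_r (p : dual) : linear (dpair p : restr M -> k^o).
Proof. by move=> c u v; rewrite /dpair linearP. Qed.

Lemma dpair_linear_l m : linear ((fun p => dpair p m) : restr dual -> k^o).
Proof.
by move=> c p q; rewrite /dpair restr_actmod add_lfunE scale_lfunE.
Qed.

Lemma dpair0l m : dpair 0 m = 0.
Proof. by rewrite -[LHS]/(lin_of (dpair_linear_l m) 0) linear0. Qed.

Lemma dpair0r p : dpair p 0 = 0.
Proof. by rewrite -[LHS]/(lin_of (dpair_linear_r p) 0) linear0. Qed.

Lemma dpairDl p q m : dpair (p + q) m = dpair p m + dpair q m.
Proof. by have := linearD (lin_of (dpair_linear_l m)) p q. Qed.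

Lemma dpairDr p m n : dpair p (m + n) = dpair p m + dpair p n.
Proof. by have := linearD (lin_of (dpair_linear_r p)) m n. Qed.

Lemma dpair_inj (p q : dual) : (forall m, dpair p m = dpair q m) -> p = q.
Proof. by move=> pq; apply/(@lfunP k (restr M) k^o). Qed.

Lemma dpair_ex (f : {linear restr M ->
  k^o}) : exists p : dual, forall m, dpair p m = f m.
Proof. by exists (linfun f) => m; rewrite /dpair lfunE. Qed.

Lemma dpair_separates m : (forall p, dpair p m = 0) -> m = 0.
Proof.
by move=> m0; apply: (@functional_separates _ (restr M)) => f;
  have [p <-] := dpair_ex f.
Qed.

(** Finite dimensionality at work: the values of [F] on the basis [d] dual to [e] are the
    coordinates of [m]. *)
Lemma dpair_repr (F : {linear restr dual ->
  k^o}) : exists m, forall p, F p = dpair p m.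
Proof.
have /choice[d dE] i := dpair_ex (coordl (V := restr M) i).
pose e i : restr M := tbase i; pose c i : k := F (d i).
exists (\sum_i c i *: e i) => p.
have -> : dpair p (\sum_i c i *: e i) = \sum_i c i * dpair p (e i).
  rewrite -[LHS]/(lin_of (dpair_linear_r p) _) linear_sum.
  by apply: eq_bigr => i _; rewrite linearZ.
have {1}-> : p = \sum_i dpair p (e i) *: (d i : restr dual) :> restr dual.
  apply: dpair_inj => m.
  rewrite -[RHS]/(lin_of (dpair_linear_l m) _) linear_sum.
  under eq_bigr => i _ do rewrite linearZ /= dE.
  rewrite -[LHS]/(lin_of (dpair_linear_r p) _) {1}[m](@tbaseE _ (restr M))
    linear_sum.
  by apply: eq_bigr => i _; rewrite linearZ /= [LHS]mulrC.
rewrite linear_sum; apply: eq_bigr => i _; rewrite linearZ; exact: mulrC.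
Qed.

End Object.

Lemma dual_map_ex M N (f : {linear M -> N}) :
  exists df : {linear dual N -> dual M}, forall p m, dpair (df p) m = dpair p (f m).
Proof.
have /choice[g gE] p := dpair_ex (lin_of (dpair_linear_r p) \o restr_lin f).
suff lg : linear g by exists (lin_of lg).
move=> a p q; apply: dpair_inj => m.
by rewrite dpairDl dpair_scale !gE /= dpairDl dpair_scale linearZ.
Qed.

End Duality.

Arguments dpair_linear_l {k R S sigma} sigmaM sigma1 {M} m.
Arguments dpair_ex {k R S sigma} sigmaM sigma1 {M} f.
Arguments dual_map_ex {k R S sigma} sigmaM sigma1 {M N} f.

Section DualExact.
Variables (k : fieldType) (R S : falgType k) (sigma : {linear R -> S}).
Hypothesis sigmaM : forall a b : R, sigma (a * b) = sigma b * sigma a.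
Hypothesis sigma1 : sigma 1 = 1.
Local Notation D := (dual sigmaM sigma1).

Lemma dual_ses X Y Z : is_ses X Y Z -> is_ses (D Z) (D Y) (D X).
Proof.
move=> [f [g fg]]; case: (fg) => fi fgE gs.
have [df dfE] := dual_map_ex sigmaM sigma1 f.
have [dg dgE] := dual_map_ex sigmaM sigma1 g.
exists dg, df; split.
- apply: lin_inj => p dp; apply: dpair_inj => z; have [y <-] := gs z.
  by rewrite -dgE dp !dpair0l.
- move=> q; split=> [dq|[p <-]]; last first.
    by apply: dpair_inj => x; rewrite dfE dgE (ses_comp0 _ fg) dpair0r dpair0l.
  have [|h hE] := @functional_extend _ (restr Y) (restr Z) (restr_lin g)
      (lin_of (dpair_linear_r q)).
    by move=> y /fgE[x <-] /=; rewrite -dfE dq dpair0l.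
  have [p pE] := dpair_ex sigmaM sigma1 h; exists p; apply: dpair_inj => y.
  by rewrite dgE pE; exact: hE.
- move=> q.
  have [|h hE] := @functional_extend _ (restr X) (restr Y) (restr_lin f)
      (lin_of (dpair_linear_r q)).
    by move=> x /(inj0 fi) -> /=; rewrite dpair0r.
  have [p pE] := dpair_ex sigmaM sigma1 h; exists p; apply: dpair_inj => x.
  by rewrite dfE pE; exact: hE.
Qed.

End DualExact.

Section Biduality.
Variables (k : fieldType) (R S : falgType k).
Variables (sigma : {linear R -> S}) (tau : {linear S -> R}).
Hypothesis sigmaM : forall a b : R, sigma (a * b) = sigma b * sigma a.
Hypothesis sigma1 : sigma 1 = 1.
Hypothesis tauM : forall a b : S, tau (a * b) = tau b * tau a.
Hypothesis tau1 : tau 1 = 1.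
Hypothesis sigmaK : cancel sigma tau.
Hypothesis tauK : cancel tau sigma.
Local Notation D := (dual sigmaM sigma1).
Local Notation D' := (dual tauM tau1).

Lemma biduality (M : fgmod S) : exists e : {linear M -> D' (D M)},
  (forall m p, dpair (e m) p = dpair p m) /\ forall F, exists m, e m = F.
Proof.
have /choice[e eE] (m : M) :=
  dpair_ex tauM tau1 (lin_of (dpair_linear_l sigmaM sigma1 m)).
have le : linear e.
  move=> a m n; apply: dpair_inj => p; rewrite eE /=.
  by rewrite dpairDl dpair_scale !eE /= dpair_scale tauK dpairDr.
exists (lin_of le); split=> [m p|F]; first exact: eE.
have [m mE] := dpair_repr (lin_of (dpair_linear_r F)); exists m.
apply: dpair_inj => p; exact: etrans (eE m p) (esym (mE p)).
Qed.

End Biduality.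

Section DualProjective.
Variables (k : fieldType) (R S : falgType k).
Variables (sigma : {linear R -> S}) (tau : {linear S -> R}).
Hypothesis sigmaM : forall a b : R, sigma (a * b) = sigma b * sigma a.
Hypothesis sigma1 : sigma 1 = 1.
Hypothesis tauM : forall a b : S, tau (a * b) = tau b * tau a.
Hypothesis tau1 : tau 1 = 1.
Hypothesis sigmaK : cancel sigma tau.
Hypothesis tauK : cancel tau sigma.
Local Notation D := (dual sigmaM sigma1).
Local Notation D' := (dual tauM tau1).

(** Dualising turns the lifting problem for the dual of [I] into an extension problem for [I]; its
    solution is dualised back and transported along biduality. *)
Lemma dual_projective (I : fgmod S) : injective_mod I -> projective (D I).
Proof.
move=> inI X Y p f ps.
have [e [eE es]] := biduality sigmaM sigma1 tauM tau1 tauK I.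
have [eX [eXE eXs]] := biduality tauM tau1 sigmaM sigma1 sigmaK X.
have ei : injective e.
  apply: lin_inj => m em;
    apply: (dpair_separates (sigmaM := sigmaM) (sigma1 := sigma1)) => q.
  by rewrite -eE em dpair0l.
have eXi : injective eX.
  apply: lin_inj => m em;
    apply: (dpair_separates (sigmaM := tauM) (sigma1 := tau1)) => q.
  by rewrite -eXE em dpair0l.
have [e' [eK e'K]] := bijective_lin_inv ei es.
have [eX' [eXK eX'K]] := bijective_lin_inv eXi eXs.
have [dp dpE] := dual_map_ex tauM tau1 p; have [df dfE] := dual_map_ex tauM tau1 f.
have dpi : injective dp.
  apply: lin_inj => t dt; apply: dpair_inj => y; have [x <-] := ps y.
  by rewrite -dpE dt !dpair0l.
have [u uE] := inI _ _ dp (e' \o df) dpi.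
have [du duE] := dual_map_ex sigmaM sigma1 u.
exists (eX' \o du) => phi /=; apply/eqP; rewrite -subr_eq0; apply/eqP.
apply: (dpair_separates (sigmaM := tauM) (sigma1 := tau1)) => theta.
rewrite -[LHS]/(lin_of (dpair_linear_r theta) _) linearB /= -dpE -eXE eX'K duE.
have /= -> := uE theta.
by rewrite -eE e'K dfE subrr.
Qed.

Lemma dual_pd_le n (M : fgmod S) : injdim_le n M -> pd_le n (D M).
Proof.
elim: n M => [|n IH] M /=; first exact: dual_projective.
move=> [I [N [iI s iN]]]; exists (D N), (D I).
by split; [exact: dual_projective|exact: dual_ses|exact: IH].
Qed.

(* Each functional on M gives a map into the dual of the regular module; those
   of a basis of functionals embed M into a power of it. *)
Lemma dual_regular_embedding n (M : fgmod R) : pd_le n (D (regmod S)) ->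
  exists (J : fgmod R) (i : {linear M -> J}), injective i /\ pd_le n J.
Proof.
move=> pS; have ex (q : {linear restr M -> k^o}) : exists h : {linear M ->
  D (regmod S)},
    forall m, h m = 0 -> q m = 0.
  (* The adjunction between Hom_R(M, DS) and Hom_k(M, k): [q] corresponds to the map sending m to
     the functional s ↦ q (tau s m), and evaluation at s = 1 gives [q] back. *)
  have lq (m : M) : linear (fun s : restr (regmod S) =>
    q (tau (s : S) *: m : M) : k^o).
    move=> c s t; have -> : tau (c *: s + t : S) = c *: tau s + tau t.
      rewrite -linearP; congr (tau (_ + _)).
      by rewrite -[LHS]/(c%:A * (s : S)) mulr_algl.
    by rewrite scalerDl restrZl linearP.
  have /choice[h hE] (m : M) := dpair_ex sigmaM sigma1 (lin_of (lq m)).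
  have lh : linear h.
    move=> a m m'; apply: dpair_inj => s; rewrite hE /=.
    rewrite dpairDl dpair_scale !hE /=.
    rewrite scalerDr (linearD q) /= scalerA.
    by rewrite -[sigma a *: s]/(sigma a * s) tauM sigmaK.
  exists (lin_of lh) => m /= hm; have := hE m 1; rewrite hm /= tau1 scale1r => <-.
  by rewrite dpair0l.
suff [J [i [iE pJ]]] : exists (J : fgmod R) (i : {linear M -> J}),
    (forall m, i m = 0 -> forall j, coordl (V := restr M) j m = 0) /\ pd_le n J.
  exists J, i; split=> //; apply: lin_inj => m /iE m0;
    apply: (@v2r_inj _ (restr M)).
  by rewrite linear0; apply/rowP => j; rewrite mxE; exact: m0.
have H (s : seq 'I_(dim (restr M))) : exists (J : fgmod R) (i : {linear M -> J}),
    (forall m, i m = 0 -> forall j, j \in s -> coordl (V :=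
      restr M) j m = 0) /\ pd_le n J.
  elim: s => [|j s [J [i [iE pJ]]]].
    have [Z Z0] := zero_mod R; exists Z, (lin0 M Z); split=> //.
    exact/pd_le_projective/projective_zero.
  have [h hE] := ex (coordl (V := restr M) j).
  exists (fgprod (D (regmod S)) J), (pairl h i); split; last exact: pd_le_prod.
  move=> m [hm im] l; rewrite inE => /predU1P[->|]; first exact: hE.
  exact: iE.
have [J [i [iE pJ]]] := H (enum 'I_(dim (restr M))); exists J, i; split=> // m im j.
by apply: iE; rewrite ?mem_enum.
Qed.

End DualProjective.

(** The right regular module is a left module over the converse algebra; its k-dual is an R-module
    of finite projective dimension, and every R-module embeds in a power of it. *)
Lemma gorenstein_gdim_le (k : fieldType) (R : falgType k) : gorenstein R ->
  exists n, forall M : fgmod R, gdim_le n M.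
Proof.
move=> [_]; pose S : falgType k := R^c; rewrite -/(finite_injdim (regmod S)).
move=> /finite_injdim_le[n iS]; exists n.
have ls : linear (id : R -> S) by [].
have lt : linear (id : S -> R) by [].
pose sigma := lin_of ls; pose tau := lin_of lt.
have sM (a b : R) : sigma (a * b) = sigma b * sigma a by [].
have tM (a b : S) : tau (a * b) = tau b * tau a by [].
have s1 : sigma 1 = 1 by []. have t1 : tau 1 = 1 by [].
have st : cancel sigma tau by []. have ts : cancel tau sigma by [].
apply: embedding_gdim_le => M.
exact: (dual_regular_embedding tM t1 st M (dual_pd_le sM s1 tM t1 st ts iS)).
Qed.

(** * Tensor products *)

Section TensorSpaces.
Variable k : fieldType.
Implicit Types U V : vectType k.

Definition bilin U V (W : lmodType k) (f : U -> V -> W) : Prop :=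
  (forall v, linear (f^~ v)) /\ (forall u, linear (f u)).

Lemma tpure_bilin U V : bilin (@tpure k U V).
Proof. by split=> [v|u]; [exact: tpure_linear_l|exact: tpure_linear_r]. Qed.

Lemma tens_lift U V (W : lmodType k) (f : U -> V -> W) : bilin f ->
  exists g : {linear tens U V -> W}, forall u v, g (tpure u v) = f u v.
Proof.
by move=> [fl fr]; exists (lin_of (tlift_linear f)) => u v; exact: tlift_tpure.
Qed.

Lemma tens_ext_lin U V (W : lmodType k) (g h : {linear tens U V -> W}) :
  (forall u v, g (tpure u v) = h (tpure u v)) -> g =1 h.
Proof. by apply: tens_ext; exact: linearP. Qed.

Lemma bilin_comp U V U' V' (f : {linear U -> U'}) (g : {linear V -> V'})
    (W : lmodType k) (h : {linear tens U' V' -> W}) :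
  bilin (fun u v => h (tpure (f u) (g v))).
Proof.
have [tl tr] := tpure_bilin U' V'.
split=> [v|u] c x y; rewrite -[RHS]linearP; congr (h _).
  by rewrite [f _]linearP; exact: (tl (g v)).
by rewrite [g _]linearP; exact: (tr (f u)).
Qed.

Lemma tens_map_ex U V U' V' (f : {linear U -> U'}) (g : {linear V -> V'}) :
  {h : {linear tens U V -> tens U' V'} |
    forall u v, h (tpure u v) = tpure (f u) (g v)}.
Proof. by apply: cid;
  exact: (tens_lift (bilin_comp f g (idfun : {linear tens U' V' -> _}))). Qed.

Definition tens_map U V U' V' (f : {linear U -> U'}) (g : {linear V -> V'}) :=
  sval (tens_map_ex f g).

Lemma tens_mapE U V U' V' (f : {linear U -> U'}) (g : {linear V -> V'}) u v :
  tens_map f g (tpure u v) = tpure (f u) (g v).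
Proof. exact: (svalP (tens_map_ex f g)). Qed.

Lemma tpureDl U V (u u' : U) (v : V) : tpure (u + u') v = tpure u v + tpure u' v.
Proof. by have := linearD (lin_of (tpure_linear_l v)) u u'. Qed.

Lemma tpureDr U V (u : U) (v v' : V) : tpure u (v + v') = tpure u v + tpure u v'.
Proof. by have := linearD (lin_of (tpure_linear_r u)) v v'. Qed.

Lemma tpure0l U V (v : V) : tpure (0 : U) v = 0.
Proof. by have := linear0 (lin_of (@tpure_linear_l k U V v)). Qed.

Lemma tpure0r U V (u : U) : tpure u (0 : V) = 0.
Proof. by have := linear0 (lin_of (@tpure_linear_r k U V u)). Qed.

End TensorSpaces.

Section TensorModule.
Variables (k : fieldType) (A B : falgType k).
Implicit Types (X : fgmod A) (Y : fgmod B).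

Section Object.
Variables (X : fgmod A) (Y : fgmod B).
Let Z : vectType k := tens (restr X) (restr Y).

Lemma scale_restr_linear (R : falgType k) (M : fgmod R) (a : R) :
  linear ((fun m => a *: (m : M)) : restr M -> restr M).
Proof. by move=> c x y; rewrite scalerDr restrZC. Qed.
Definition scale_restr (R : falgType k) (M : fgmod R) (a : R) :=
  lin_of (@scale_restr_linear R M a).

Let elem_act (a : A) (b : B) : {linear Z -> Z} :=
  tens_map (scale_restr X a) (scale_restr Y b).

Let elem_actE a b x y :
  elem_act a b (tpure x y) = tpure (a *: (x : X) : restr X) (b *: (y : Y) : restr
    Y).
Proof. exact: tens_mapE. Qed.

Let elem_act_l b z : linear (fun a => elem_act a b z).
Proof.
move=> c a a'.
have lh : linear (fun z => c *: elem_act a b z + elem_act a' b z).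
  by move=> d u v; rewrite !linearP /= addrACA !scalerA [c * d]mulrC.
apply: (@tens_ext_lin _ _ _ _ _ (lin_of lh)) => x y /=; rewrite !elem_actE.
by rewrite scalerDl restrZl; exact: (@tpure_linear_l k (restr X) (restr Y)).
Qed.

Let elem_act_r a z : linear (fun b => elem_act a b z).
Proof.
move=> c b b'.
have lh : linear (fun z => c *: elem_act a b z + elem_act a b' z).
  by move=> d u v; rewrite !linearP /= addrACA !scalerA [c * d]mulrC.
apply: (@tens_ext_lin _ _ _ _ _ (lin_of lh)) => x y /=; rewrite !elem_actE.
by rewrite scalerDl restrZl; exact: (@tpure_linear_r k (restr X) (restr Y)).
Qed.

Definition tensor_act (s : A ⊗ B) (z : tens (restr X) (restr Y)) :
    tens (restr X) (restr Y) :=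
  tlift (fun a b => elem_act a b z) (s : tens A B).

Lemma tensor_act_elem a b z : tensor_act (tpure a b : A ⊗ B) z = elem_act a b z.
Proof. by rewrite /tensor_act tlift_tpure. Qed.

Lemma tensor_act_tpure a b x y : tensor_act (tpure a b : A ⊗ B) (tpure x y) =
  tpure (a *: (x : X) : restr X) (b *: (y : Y) : restr Y).
Proof. by rewrite tensor_act_elem elem_actE. Qed.

Let actl z : linear (tensor_act^~ z).
Proof. by move=> c s s'; exact: tlift_linear. Qed.

Let actr s : linear (tensor_act s).
Proof. by move=> c z z'; apply: tlift_fun => a b; rewrite linearP. Qed.

Let actM' s s' z : tensor_act (s * s') z = tensor_act s (tensor_act s' z).
Proof.
move: s; apply: tens_ext => [|c s t|a b]; first 2 last.
- move: s'; apply: tens_ext => [c s t|c s t|a' b'].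
  + by rewrite -actl; congr (tensor_act _ _); rewrite mulrDr scalerAr.
  + by rewrite actl actr.
  rewrite tpureM tensor_act_elem tensor_act_elem tensor_act_elem.
  move: z; apply: (@tens_ext_lin _ _ _ _ _ (elem_act a b \o elem_act a' b')) =>
    x y /=.
  by rewrite !elem_actE !scalerA.
- by move=> c s t; rewrite -actl; congr (tensor_act _ _); rewrite mulrDl scalerAl.
- exact: actl.
Qed.

Let act1' z : tensor_act 1 z = z.
Proof.
rewrite -tpure11 tensor_act_elem; move: z.
apply: (@tens_ext_lin _ _ _ _ _ idfun) => x y /=.
by rewrite elem_actE !scale1r.
Qed.

Definition tensor : fgmod (A ⊗ B) := actfg (Action actl actr actM' act1').

Definition tp (x : X) (y : Y) : tensor := tpure (x : restr X) (y : restr Y).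

Lemma tpE a b x y : (tpure a b : A ⊗ B) *: tp x y = tp (a *: x) (b *: y).
Proof. exact: tensor_act_tpure. Qed.

Lemma restr_tensor c (z : restr tensor) : c *: z = (c *: (z : tens (restr X)
  (restr Y))).
Proof. exact: restr_actmod. Qed.

Lemma tensor_ext (N : fgmod (A ⊗ B)) (g h : {linear tensor -> N}) :
  (forall x y, g (tp x y) = h (tp x y)) -> g =1 h.
Proof.
move=> gh; apply: (@tens_ext _ _ _ (restr N) (g : _ -> restr N)) => // c z z'.
  by have := linearP (restr_lin g) c z z'; rewrite restr_tensor.
by have := linearP (restr_lin h) c z z'; rewrite restr_tensor.
Qed.

Lemma tensor_lift (N : fgmod (A ⊗ B)) (f : restr X -> restr Y ->
  restr N) : bilin f ->
    (forall a b x y, f (a *: (x : X)) (b *: (y : Y)) = (tpure a b : A ⊗ B) *: (f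
      x y : N)) ->
  exists g : {linear tensor -> N}, forall x y, g (tp x y) = f x y.
Proof.
move=> bf fE; have [g gE] := tens_lift bf.
suff lg : linear (g : tensor -> N) by exists (lin_of lg).
move=> s z z'; rewrite (linearD g); congr (_ + _); move: s.
apply: (@tens_ext _ A B (restr N) (fun s => g ((s : A ⊗ B) *: (z : tensor)))
  (fun s => (s : A ⊗ B) *: (g z : N))) => [c s t|c s t|a b].
- by rewrite -linearP; congr (g _); exact: actl.
- by rewrite scalerDl restrZl.
have lh : linear (fun z => (tpure a b : A ⊗ B) *: (g z : N) : restr N).
  by move=> c u v; rewrite linearP scalerDr restrZC.
move: z; apply: (@tens_ext _ _ _ (restr N) (fun z : tens _ _ =>
  g ((tpure a b : A ⊗ B) *: (z : tensor))) _ _ lh).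
  by move=> c u v; rewrite -linearP; congr (g _); exact: actr.
by move=> x y; rewrite -[tpure x y]/(tp x y) tpE !gE fE.
Qed.

End Object.
End TensorModule.

Section KSplitting.
Variables (k : fieldType) (R : falgType k).
Implicit Types X Y Z : fgmod R.

Lemma ses_ksplit X Y Z (f : {linear X -> Y}) (g : {linear Y -> Z}) : ses f g ->
  exists (r : {linear restr Y -> restr X}) (s : {linear restr Z -> restr Y}),
    [/\ forall x, r (f x) = x, forall z, g (s z) = z & forall y, f (r y) + s (g
      y) = y].
Proof.
move=> sfg; case: (sfg) => fi fgE gs.
pose F := linfun (restr_lin f); pose G := linfun (restr_lin g).
have FE x : F x = f x by rewrite lfunE.
have GE y : G y = g y by rewrite lfunE.
have kF : lker F == 0%VS by apply/lker0P => x y; rewrite !FE => /fi.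
pose r : {linear restr Y -> restr X} := F^-1%VF.
have rf (x : restr X) : r (f x) = x by rewrite -FE /= lker0_lfunK.
have gG (z : restr Z) : g (G^-1%VF z) = z.
  rewrite -GE limg_lfunVK //; have [y <-] := gs z; rewrite -GE.
  by rewrite memv_img ?memvf.
(* A right inverse of [g] is corrected by the projection along the image of [f], which makes the two
   splittings complementary. *)
pose s : {linear restr Z -> restr Y} :=
  (idfun \- (restr_lin f \o r)) \o (G^-1%VF : {linear restr Z -> restr Y}).
exists r, s; split=> // [z|y].
  by rewrite /= linearB /= gG (ses_comp0 _ sfg) subr0.
have /fgE[x xE] : g (G^-1%VF (g y) - y) = 0 by rewrite linearB /= gG subrr.
have -> : s (g y) = y - f (r y).
  have yE : G^-1%VF (g y) = f x + y by rewrite xE subrK.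
  rewrite /s /= yE (linearD r) (linearD (restr_lin f)) /= rf opprD addrACA.
  by rewrite subrr add0r.
by rewrite addrC subrK.
Qed.

End KSplitting.

Section TensorProperties.
Variables (k : fieldType) (A B : falgType k).
Implicit Types (X : fgmod A) (Y : fgmod B) (Z : fgmod (A ⊗ B)).

Lemma tp_bilin X Y : bilin (@tp k A B X Y : restr X -> restr Y ->
  restr (tensor X Y)).
Proof.
have [tl tr] := tpure_bilin (restr X) (restr Y).
by split=> [y|x] c u v; rewrite restr_tensor; [exact: tl|exact: tr].
Qed.

Definition bilin_of (U V W : lmodType k) (f : U -> V -> W)
    (fl : forall v, linear (f^~ v)) (fr : forall u, linear (f u)) :
  {bilinear U -> V -> W} :=
    HB.pack f (bilinear_isBilinear.Build _ _ _ _ _ _ f (fl, fr)).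

Lemma bilinear_bilin (U V : vectType k) (W : lmodType k) (f : {bilinear U -> V ->
  W}) :
  bilin f.
Proof.
split=> [v|u] c x y; first by rewrite linearPl.
by rewrite linearPr.
Qed.

Lemma bilinear_exists (U V : vectType k) (W : lmodType k) (f : U -> V -> W) :
  bilin f -> exists g : {bilinear U -> V -> W}, forall u v, g u v = f u v.
Proof. by move=> [fl fr]; exists (bilin_of fl fr). Qed.

Lemma tensor_is_tensor X Y : is_tensor X Y (tensor X Y).
Proof.
have [t tE] := bilinear_exists (tp_bilin X Y); exists t; split; last first.
  by move=> a b x y; rewrite !tE tpE.
move=> V f; have [g gE] := tens_lift (bilinear_bilin f).
have lg : linear (g : restr (tensor X Y) -> V).
  by move=> c u v; rewrite restr_tensor linearP.
exists (lin_of lg); split=> [x y|g' g'E z]; first by rewrite tE; exact: gE.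
have lg' : linear (g' : tens (restr X) (restr Y) -> V).
  by move=> c u v; rewrite -linearP; congr (g' _); rewrite restr_tensor.
by apply: (@tens_ext_lin _ _ _ _ (lin_of lg') g) => x y; rewrite gE -g'E tE.
Qed.

Lemma is_tensor_iso X Y Z : is_tensor X Y Z -> isomorphic (tensor X Y) Z.
Proof.
move=> [t [tu tE]]; have [|h hE] := tensor_lift (bilinear_bilin t).
  by move=> a b x y; rewrite tE.
have [p pE] := bilinear_exists (tp_bilin X Y).
have [g [gE _]] := tu _ p.
have [i [_ i1]] := tu _ t.
exists h; exists g => z.
  move: z; have lgh : linear (fun z : tens (restr X) (restr Y) =>
    g (h z) : restr (tensor X Y)).
    move=> c u v; have /= e := linearP (restr_lin h) c u v.
    by rewrite restr_tensor in e; rewrite e linearP.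
  apply: (tens_ext (h := idfun : tens (restr X) (restr Y) ->
    restr (tensor X Y)) lgh).
    by move=> c u v /=; rewrite restr_tensor.
  by move=> x y; have := hE x y; rewrite /tp => ->; rewrite gE pE.
(* [h \o g] and the identity agree on all [t x y], so uniqueness in the universal property of [Z]
   identifies them. *)
have hgt x y : (restr_lin h \o g) (t x y) = t x y by rewrite /= gE pE hE.
have e : h (g z) = i z := i1 (restr_lin h \o g) hgt z.
have e' : z = i z := i1 (idfun : {linear restr Z -> restr Z}) (fun _ _ => erefl) z.
by rewrite e -e'.
Qed.

Lemma iso_is_tensor X Y Z : isomorphic (tensor X Y) Z -> is_tensor X Y Z.
Proof.
move=> /isomorphicP[f [f' [fK f'K]]].
have [t [tu tE]] := tensor_is_tensor X Y.
have tb : bilin (fun x y => restr_lin f (t x y)).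
  by have [tl tr] := bilinear_bilin t; split=> [y|x] c u v;
    rewrite -linearP; congr (restr_lin f _); [exact: tl|exact: tr].
have [t' t'E] := bilinear_exists tb; exists t'; split; last first.
  by move=> a b x y; rewrite !t'E /= -tE linearZ.
move=> V b; have [g [gE gu]] := tu V b.
exists (g \o restr_lin f'); split=> [x y|g' g'E z]; first by rewrite t'E /= fK.
rewrite -[z]f'K /= fK; apply: (gu (g' \o restr_lin f)) => x y /=.
by rewrite -g'E t'E.
Qed.

Lemma tensor_classE C D Z : tensor_class C D Z <->
  exists (X : fgmod A) (Y : fgmod B), [/\ C X, D Y & isomorphic (tensor X Y) Z].
Proof.
split=> -[X [Y [CX DY t]]]; exists X, Y; split=> //; first exact: is_tensor_iso.
exact: iso_is_tensor.
Qed.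

Lemma tensor_map_ex X X' Y Y' (f : {linear X -> X'}) (g : {linear Y -> Y'}) :
  exists h : {linear tensor X Y ->
    tensor X' Y'}, forall x y, h (tp x y) = tp (f x) (g y).
Proof.
have [tl tr] := tp_bilin X' Y'.
apply: (tensor_lift (f := fun x y => tp (f x) (g y))).
  split=> [y|x] c u v.
    by have /= -> := linearP (restr_lin f) c u v; exact: tl.
  by have /= -> := linearP (restr_lin g) c u v; exact: tr.
by move=> a b x y; rewrite !linearZ tpE.
Qed.

(** Brings module maps down to k-linear ones, so that they can be composed with tensored
    k-splittings, which are not module maps. *)
Lemma tensor_tens_map X X' Y Y' (f : {linear X -> X'}) (g : {linear Y -> Y'})
    (h : {linear tensor X Y -> tensor X' Y'}) :
  (forall x y, h (tp x y) = tp (f x) (g y)) ->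
  forall z, h z = tens_map (restr_lin f) (restr_lin g) z.
Proof.
move=> hE.
apply: (@tens_ext _ (restr X) (restr Y)) => [c u v|c u v|x y].
- by have := linearP (restr_lin h) c u v; rewrite !restr_tensor.
- exact: linearP.
by rewrite tens_mapE; exact: hE.
Qed.

Lemma tens_map_comp (U1 U2 U3 V1 V2 V3 : vectType k) (f : {linear U1 -> U2})
    (f' : {linear U2 -> U3}) (g : {linear V1 -> V2}) (g' : {linear V2 -> V3})
    (h : {linear U1 -> U3}) (h' : {linear V1 -> V3}) :
    (forall u, f' (f u) = h u) -> (forall v, g' (g v) = h' v) ->
  forall z, tens_map f' g' (tens_map f g z) = tens_map h h' z.
Proof.
move=> fE gE; apply: (@tens_ext_lin _ _ _ _ (tens_map f' g' \o tens_map f g)) =>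
  u v /=.
by rewrite !tens_mapE fE gE.
Qed.

Lemma tens_map_id (U V : vectType k) (f : {linear U -> U}) (g : {linear V -> V}) :
  (forall u, f u = u) -> (forall v, g v = v) -> forall z, tens_map f g z = z.
Proof.
move=> fE gE; apply: (@tens_ext_lin _ _ _ _ _ idfun) => u v /=.
by rewrite tens_mapE fE gE.
Qed.

Lemma tens_mapDl (U V U' V' : vectType k) (f f' h : {linear U ->
  U'}) (g : {linear V -> V'}) :
    (forall u, h u = f u + f' u) ->
  forall z, tens_map h g z = tens_map f g z + tens_map f' g z.
Proof.
move=> hE; apply: (@tens_ext_lin _ _ _ _ _ (tens_map f g \+ tens_map f' g)) =>
  u v /=.
by rewrite !tens_mapE hE tpureDl.
Qed.

Lemma tens_mapDr (U V U' V' : vectType k) (f : {linear U ->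
  U'}) (g g' h : {linear V -> V'}) :
    (forall v, h v = g v + g' v) ->
  forall z, tens_map f h z = tens_map f g z + tens_map f g' z.
Proof.
move=> hE; apply: (@tens_ext_lin _ _ _ _ _ (tens_map f g \+ tens_map f g')) =>
  u v /=.
by rewrite !tens_mapE hE tpureDr.
Qed.

Lemma tens_map0l (U V U' V' : vectType k) (f : {linear U ->
  U'}) (g : {linear V -> V'}) :
  (forall u, f u = 0) -> forall z, tens_map f g z = 0.
Proof.
move=> f0; apply: (@tens_ext_lin _ _ _ _ _ \0) => u v /=.
by rewrite tens_mapE f0 tpure0l.
Qed.

Lemma tens_map0r (U V U' V' : vectType k) (f : {linear U ->
  U'}) (g : {linear V -> V'}) :
  (forall v, g v = 0) -> forall z, tens_map f g z = 0.
Proof.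
move=> g0; apply: (@tens_ext_lin _ _ _ _ _ \0) => u v /=.
by rewrite tens_mapE g0 tpure0r.
Qed.

(* Exactness of the tensor product comes from splittings over k, which it
   preserves. *)
Lemma ses_of_ksplit (R : falgType k) (X Y Z : fgmod R) (f : {linear X -> Y})
    (g : {linear Y -> Z}) (r : Y -> X) (s : Z -> Y) : s 0 = 0 ->
    (forall x, r (f x) = x) -> (forall z, g (s z) = z) ->
    (forall x, g (f x) = 0) -> (forall y, f (r y) + s (g y) = y) -> ses f g.
Proof.
move=> s0 rf gs gf fs; split=> [||z]; first exact: can_inj rf.
- move=> y; split=> [gy|[x <-] //]; exists (r y).
  by rewrite -[RHS]fs gy s0 addr0.
- by exists (s z).
Qed.

Lemma tensor_ses_l X1 X2 X3 Y : is_ses X1 X2 X3 ->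
  is_ses (tensor X1 Y) (tensor X2 Y) (tensor X3 Y).
Proof.
move=> [f [g fg]]; have [r [s [rf gs fs]]] := ses_ksplit fg.
have [F FE] := tensor_map_ex f (lin_id Y);
  have [G GE] := tensor_map_ex g (lin_id Y).
pose idk : {linear restr Y -> restr Y} := idfun.
have Fz := tensor_tens_map FE; have Gz := tensor_tens_map GE.
exists F, G; apply: (@ses_of_ksplit _ _ _ _ F G (tens_map r idk) (tens_map s idk)).
- exact: (linear0 (tens_map s idk)).
- move=> z; rewrite Fz; rewrite (@tens_map_comp _ _ _ _ _ _ _ _ _ _ idfun idk) //.
  exact: tens_map_id.
- move=> z; rewrite Gz; rewrite (@tens_map_comp _ _ _ _ _ _ _ _ _ _ idfun idk) //.
  exact: tens_map_id.
- move=> z; rewrite Gz Fz; rewrite (@tens_map_comp _ _ _ _ _ _ _ _ _ _ (\0) idk) //.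
    exact: tens_map0l.
  by move=> x; exact: ses_comp0 fg.
move=> z; rewrite Fz Gz.
rewrite (@tens_map_comp _ _ _ _ _ _ _ _ _ _ (restr_lin f \o r) idk) //.
rewrite (@tens_map_comp _ _ _ _ _ _ _ _ _ _ (s \o restr_lin g) idk) //.
rewrite -[RHS](@tens_map_id _ _ idfun idk) //; symmetry.
by apply: tens_mapDl => y; rewrite /= fs.
Qed.

Lemma tensor_ses_r X Y1 Y2 Y3 : is_ses Y1 Y2 Y3 ->
  is_ses (tensor X Y1) (tensor X Y2) (tensor X Y3).
Proof.
move=> [f [g fg]]; have [r [s [rf gs fs]]] := ses_ksplit fg.
have [F FE] := tensor_map_ex (lin_id X) f;
  have [G GE] := tensor_map_ex (lin_id X) g.
pose idk : {linear restr X -> restr X} := idfun.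
have Fz := tensor_tens_map FE; have Gz := tensor_tens_map GE.
exists F, G; apply: (@ses_of_ksplit _ _ _ _ F G (tens_map idk r) (tens_map idk s)).
- exact: (linear0 (tens_map idk s)).
- move=> z; rewrite Fz; rewrite (@tens_map_comp _ _ _ _ _ _ _ _ _ _ idk idfun) //.
  exact: tens_map_id.
- move=> z; rewrite Gz; rewrite (@tens_map_comp _ _ _ _ _ _ _ _ _ _ idk idfun) //.
  exact: tens_map_id.
- move=> z; rewrite Gz Fz; rewrite (@tens_map_comp _ _ _ _ _ _ _ _ _ _ idk (\0)) //.
    exact: tens_map0r.
  by move=> x; exact: ses_comp0 fg.
move=> z; rewrite Fz Gz.
rewrite (@tens_map_comp _ _ _ _ _ _ _ _ _ _ idk (restr_lin f \o r)) //.
rewrite (@tens_map_comp _ _ _ _ _ _ _ _ _ _ idk (s \o restr_lin g)) //.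
rewrite -[RHS](@tens_map_id _ _ idk idfun) //; symmetry.
by apply: tens_mapDr => y; rewrite /= fs.
Qed.

End TensorProperties.

Section TensorSums.
Variables (k : fieldType) (A B : falgType k).
Implicit Types (X : fgmod A) (Y : fgmod B).

Lemma tp_suml X Y (I : finType) (x : I -> X) (y : Y) :
  tp (\sum_i x i) y = \sum_i tp (x i) y :> tensor X Y.
Proof.
have [tl _] := tp_bilin X Y.
exact: (linear_sum (lin_of (tl y))).
Qed.

Lemma tp_sumr X Y (I : finType) (x : X) (y : I -> Y) :
  tp x (\sum_i y i) = \sum_i tp x (y i) :> tensor X Y.
Proof.
have [_ tr] := tp_bilin X Y.
exact: (linear_sum (lin_of (tr x))).
Qed.

Lemma tpZl X Y (c : k) (x : X) (y : Y) :
  tp (c *: (x : restr X)) y = c *: (tp x y : restr (tensor X Y)).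
Proof.
have [tl _] := tp_bilin X Y.
by have := linearZ_LR (lin_of (tl y)) c x.
Qed.

Lemma tpZr X Y (c : k) (x : X) (y : Y) :
  tp x (c *: (y : restr Y)) = c *: (tp x y : restr (tensor X Y)).
Proof.
have [_ tr] := tp_bilin X Y.
by have := linearZ_LR (lin_of (tr x)) c y.
Qed.

End TensorSums.

Section TensorProjective.
Variables (k : fieldType) (A B : falgType k).
Implicit Types (X : fgmod A) (Y : fgmod B).

(** Tensors of basis vectors behave as a basis: their images are lifted one by one, and [phi] is the
    bilinear map that these lifts prescribe. *)
Lemma tensor_free_projective n m :
  projective (tensor (free_mod A n) (free_mod B m)).
Proof.
move=> X Y p f ps.
have /choice[x xE] (ij : 'I_n * 'I_m) :=
  ps (f (tp (delta_mx 0 ij.1 : free_mod A n) (delta_mx 0 ij.2 : free_mod B m))).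
pose phi (u : restr (free_mod A n)) (v : restr (free_mod B m)) : restr X :=
  \sum_i \sum_j (tpure ((u : 'rV_n) 0 i) ((v : 'rV_m) 0 j) : A ⊗ B) *: x (i, j).
have [|a b u v|h hE] := @tensor_lift _ _ _ (free_mod A n) (free_mod B m) X phi.
- split=> [v|u] c y z; rewrite /phi scaler_sumr -big_split;
  apply: eq_bigr => i _ /=;
    rewrite scaler_sumr -big_split; apply: eq_bigr => j _ /=;
    rewrite !mxE mulr_algl.
    by rewrite [tpure _ _]tpure_linear_l scalerDl restrZl.
  by rewrite [tpure _ _]tpure_linear_r scalerDl restrZl.
- rewrite /phi scaler_sumr; apply: eq_bigr => i _.
  rewrite scaler_sumr; apply: eq_bigr => j _.
  by rewrite !mxE scalerA tpureM.
exists h; apply: (@tensor_ext _ _ _ _ _ _ (p \o h)) => u v.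
rewrite /= hE {2}[u]row_sum_delta {2}[v]row_sum_delta tp_suml !linear_sum.
apply: eq_bigr => i _; rewrite tp_sumr !linear_sum; apply: eq_bigr => j _ /=.
by rewrite -tpE !linearZ /= xE.
Qed.

Lemma tensor_projective X Y : projective X -> projective Y ->
  projective (tensor X Y).
Proof.
move=> /projective_free_retract[n [i [r riK]]] /projective_free_retract[m [j [s
  sjK]]].
have [h hE] := tensor_map_ex i j; have [g gE] := tensor_map_ex r s.
apply: (projective_retract (i := h) (r := g)); last exact: tensor_free_projective.
by apply: (@tensor_ext _ _ _ _ _ _ (g \o h) idfun) => x y /=; rewrite hE gE riK sjK.
Qed.

Lemma tensor_regular : isomorphic (tensor (regmod A) (regmod B)) (regmod (A ⊗ B)).
Proof.
have [||h hE] := @tensor_lift _ A B (regmod A) (regmod B) (regmod (A ⊗ B))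
    (fun a b => tpure (a : A) (b : B)).
- have e (R : falgType k) c (x : restr (regmod R)) : c *: x = c *: (x : R).
    by rewrite -mulr_algl.
  by split=> [b|a] c x y; rewrite !e; [exact: tpure_linear_l|exact: tpure_linear_r].
- by move=> a b x y; rewrite -[RHS]/(_ * _ : A ⊗ B) tpureM.
have lg : linear (fun s : regmod (A ⊗ B) => s *: tp (1 : regmod A) (1 : regmod B)).
  by move=> a s t; rewrite scalerDl scalerA.
exists h, (lin_of lg).
  apply: (@tensor_ext _ _ _ _ _ _ (lin_of lg \o h) idfun) => x y /=.
  by rewrite hE tpE -[x *: 1]/(x * 1) -[y *: 1]/(y * 1) !mulr1.
move=> s; rewrite /= linearZ hE -[LHS]/(s * 1 : A ⊗ B).
exact: mulr1.
Qed.

End TensorProjective.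

(** * Injective modules over a tensor product *)

Section InjectiveCriterion.
Variables (k : fieldType) (R : falgType k).
Implicit Types I X Y : fgmod R.

(* The dual basis criterion: the maps eps q and the elements c p q describe a
   retraction of the coinduced module Hom_k(R, k)^Q onto I. *)
Definition coinduced_retract I : Prop :=
  exists (P Q : finType) (a : P -> R) (eps : Q -> {linear restr I -> k^o})
         (c : P -> Q -> restr I),
  (forall x : I, x = \sum_q \sum_p (eps q (a p *: x) : k) *: c p q) /\
  forall (psi : {linear R -> k^o}) b q,
    \sum_p (psi (a p * b) : k) *: c p q = b *: (\sum_p (psi (a p) : k) *: c p q :
      I).

(** The functionals [eps q \o f] extend over k from [X] to [Y]. Inserting the extensions in the dual
    basis formula defines the extension of [f], and the second condition makes it R-linear. *)
Lemma coinduced_retract_injective I : coinduced_retract I -> injective_mod I.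
Proof.
move=> [P [Q [a [eps [c [c1 c2]]]]]] X Y i f ii.
have /choice[chi chiE] (q : Q) : exists h : {linear restr Y -> k^o},
    forall x, h (i x) = eps q (f x).
  apply: (functional_extend (f := restr_lin i) (p := eps q \o restr_lin f)) =>
    x /(inj0 ii) -> /=.
  by rewrite (linear0 f) linear0.
pose h (y : Y) : I := \sum_q \sum_p (chi q (a p *: y) : k) *: c p q.
suff lh : linear h.
  exists (lin_of lh) => x; rewrite [RHS]c1 /= /h.
  by apply: eq_bigr => q _; apply: eq_bigr => p _; rewrite -!linearZ chiE.
move=> b y z; rewrite /h scaler_sumr -big_split; apply: eq_bigr => q _ /=.
have lpsi : linear (fun r : R => chi q (r *: y : Y) : k^o).
  by move=> d r s; rewrite scalerDl restrZl linearP.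
rewrite -(c2 (lin_of lpsi)) -big_split; apply: eq_bigr => p _ /=.
by rewrite scalerDr linearD scalerDl scalerA.
Qed.

Section Coinduced.
Variable I : fgmod R.

Lemma mulr_linear (a : R) : linear (fun r : R => r * a).
Proof. by move=> c r s; rewrite mulrDl scalerAl. Qed.

Let V : vectType k := 'Hom(R, restr I).
Let act (a : R) (p : 'Hom(R, restr I)) : 'Hom(R, restr I) :=
  linfun (p \o lin_of (mulr_linear a)).

Let actE a p r : act a p r = p (r * a).
Proof. exact: lfunE. Qed.

Let actl p : linear (act^~ p).
Proof.
move=> c a b; apply/lfunP => r; rewrite add_lfunE scale_lfunE !actE.
by rewrite mulrDr -scalerAr linearP.
Qed.

Let actr a : linear (act a).
Proof.
by move=> c p q; apply/lfunP => r;
  rewrite add_lfunE scale_lfunE !actE add_lfunE scale_lfunE.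
Qed.

Let actM' a b p : act (a * b) p = act a (act b p).
Proof. by apply/lfunP => r; rewrite !actE mulrA. Qed.

Let act1' p : act 1 p = p.
Proof. by apply/lfunP => r; rewrite actE mulr1. Qed.

Let coind : fgmod R := actfg (Action actl actr actM' act1').

Lemma injective_coinduced_retract : injective_mod I -> coinduced_retract I.
Proof.
move=> inI.
have lo (x : I) : linear (fun r : R => r *: x : restr I).
  by move=> c r s; rewrite scalerDl restrZl.
(* [I] embeds in the coinduced module Hom_k(R, I) by x ↦ (r ↦ r x), and its injectivity gives a
   retraction [rho]. *)
pose iota (x : I) : coind := linfun (lin_of (lo x)).
have iotaE x r : (iota x : 'Hom(R, restr I)) r = r *: x by exact: lfunE.
have li : linear iota.
  move=> a x y; apply/(@lfunP k R (restr I)) => r.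
  by rewrite iotaE add_lfunE [X in _ = X + _]actE !iotaE scalerDr scalerA.
have ii : injective (lin_of li).
  move=> x y /= xy; rewrite -[x]scale1r -[y]scale1r.
  by rewrite -iotaE xy iotaE.
have [rho rhoE] := inI _ _ (lin_of li) (lin_id I) ii.
pose e q : restr I := tbase q.
have ld (psi : {linear R -> k^o}) q : linear (fun r : R => (psi r : k) *: e q).
  by move=> c r s; rewrite linearP scalerDl scalerA.
pose th (psi : {linear R -> k^o}) q : coind := linfun (lin_of (ld psi q)).
have thE psi q r : (th psi q : 'Hom(R, restr I)) r = (psi r : k) *: e q by exact:
  lfunE.
(* The maps [th (coordl p) q], sending basis vectors to basis vectors or 0, form a basis of Hom_k(R,
   I). In terms of the values [c] of [rho] on it, the two conditions say that [rho] retracts [iota]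
   and is R-linear. *)
pose c p q : restr I := rho (th (coordl p) q).
have rhoP (F : finType) (d : F -> k) (t : F -> coind) :
    \sum_f d f *: (rho (t f) : restr I) = rho (\sum_f d f *: (t f : restr coind)).
  rewrite -[RHS]/(restr_lin rho _) linear_sum; apply: eq_bigr => f _.
  by rewrite linearZ.
have thsum (psi : {linear R -> k^o}) q :
    \sum_p (psi (tbase p) : k) *: (th (coordl p) q : restr coind) = th psi q.
  have sE (F : finType) (d : F -> restr coind) r :
      ((\sum_f d f : restr coind) : 'Hom(R, restr I)) r =
      \sum_f (d f : 'Hom(R, restr I)) r.
    exact: (@sum_lfunE _ R (restr I)).
  apply/(@lfunP k R (restr I)) => r; rewrite sE thE.
  under eq_bigr => p _.
    rewrite restr_actmod scale_lfunE thE scalerA; over.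
  rewrite -scaler_suml; congr (_ *: _).
  rewrite [r in RHS]tbaseE linear_sum; apply: eq_bigr => p _.
  by rewrite linearZ mulrC.
exists 'I_(dim R), 'I_(dim (restr I)), (@tbase _ R), (fun q => coordl q), c; split.
  move=> x; rewrite -[LHS]rhoE /=.
  have eq1 q : linear (fun r : R => coordl q (r *: x : restr I) : k^o).
    by move=> d r s; rewrite scalerDl restrZl linearP.
  under eq_bigr => q _.
    rewrite rhoP (thsum (lin_of (eq1 q))); over.
  have -> : iota x = \sum_q th (lin_of (eq1 q)) q.
    apply/(@lfunP k R (restr I)) => r; rewrite iotaE.
    rewrite (@sum_lfunE _ R (restr I)).
    rewrite [LHS](@tbaseE _ (restr I)); apply: eq_bigr => q _.
    by rewrite thE.
  exact: linear_sum.
move=> psi b q.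
have lb : linear (fun r : R => psi (r * b) : k^o).
  by move=> d r s; rewrite mulrDl -scalerAl linearP.
rewrite !rhoP (thsum psi) (thsum (lin_of lb)) -linearZ; congr (rho _).
apply/(@lfunP k R (restr I)) => r; rewrite thE.
by rewrite [RHS]actE thE.
Qed.
End Coinduced.
End InjectiveCriterion.

Section TensorInjective.
Variables (k : fieldType) (A B : falgType k).
Implicit Types (X : fgmod A) (Y : fgmod B).

Lemma scale_restr_sum (R : falgType k) (M : fgmod R) (a : R) (I : finType)
    (F : I -> restr M) :
  a *: (\sum_i F i : restr M) = \sum_i (a *: (F i : M) : restr M) :> M.
Proof. exact: (linear_sum (scale_restr M a)). Qed.

(** The criterion is a finite set of vectors and functionals subject to equations, so products of
    the data for [X] and [Y] are data for the tensor product. *)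
Lemma tensor_coinduced_retract X Y : coinduced_retract X -> coinduced_retract Y ->
  coinduced_retract (tensor X Y).
Proof.
move=> [P [Q [a [eps [c [c1 c2]]]]]] [P' [Q' [a' [eps' [c' [c1' c2']]]]]].
have bf (q : Q * Q') : bilin (fun (x : restr X) (y : restr Y) =>
    (eps q.1 x : k) *: (eps' q.2 y) : k^o).
  split=> [y|x] d u v; first by rewrite linearP scalerDl scalerA.
  by rewrite linearP scalerDr !scalerA [d * _]mulrC.
have /choice[h hE] (q : Q * Q') : exists g : {linear restr (tensor X Y) -> k^o},
    forall x y, g (tp x y) = (eps q.1 x : k) *: (eps' q.2 y).
  have [g gE] := tens_lift (bf q).
  suff lg : linear (g : restr (tensor X Y) -> k^o) by exists (lin_of lg).
  by move=> d u v; rewrite restr_tensor linearP.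
exists (P * P')%type, (Q * Q')%type, (fun p => tpure (a p.1) (a' p.2)), h.
exists (fun p q => tp (c p.1 q.1) (c' p.2 q.2)); split.
  pose F (x : tensor X Y) : tensor X Y := \sum_q \sum_p
    (h q ((tpure (a p.1) (a' p.2) : A ⊗ B) *: x) : k) *:
      (tp (c p.1 q.1) (c' p.2 q.2) : restr (tensor X Y)).
  have lF : linear (F : restr (tensor X Y) -> restr (tensor X Y)).
    move=> d u v; rewrite /F scaler_sumr -big_split; apply: eq_bigr => q _ /=.
    rewrite scaler_sumr -big_split; apply: eq_bigr => p _ /=.
    have /= -> := linearP (h q \o scale_restr (tensor X Y) (tpure (a p.1) (a'
      p.2))) d u v.
    by rewrite scalerDl scalerA.
  apply: (@tens_ext _ _ _ (restr (tensor X Y)) idfun F) => [d u v|d u v|x y].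
  - by rewrite /= restr_tensor.
  - by rewrite -restr_tensor; exact: lF.
  pose G q q' p p' : restr (tensor X Y) :=
    ((eps q (a p *: (x : X)) : k) * (eps' q' (a' p' *: (y : Y)) : k)) *: (tp (c p
      q) (c' p' q') : restr (tensor X Y)).
  transitivity (\sum_q \sum_p G q.1 q.2 p.1 p.2); last first.
    apply: eq_bigr => q _; apply: eq_bigr => p _.
    by rewrite -[tpure x y]/(tp x y) tpE hE.
  rewrite -(pair_bigA _ (fun q q' => \sum_p G q q' p.1 p.2)) /=.
  rewrite -[LHS]/(tp x y) {1}[x]c1 {1}[y]c1' tp_suml; apply: eq_bigr => q _.
  rewrite tp_sumr; apply: eq_bigr => q' _.
  rewrite -(pair_bigA _ (fun p p' => G q q' p p')) /= tp_suml;
    apply: eq_bigr => p _.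
  rewrite tp_sumr; apply: eq_bigr => p' _.
  by rewrite tpZl tpZr scalerA.
move=> psi b [q q'] /=; pose T p p' : restr (tensor X Y) := tp (c p q) (c' p' q').
(* A functional on A ⊗ B need not be a product, but fixing one argument leaves a functional on the
   other factor. So the equation is checked for b = (1 ⊗ b2)(b1 ⊗ 1), one factor at a time. *)
have e2 (phi : {linear B -> k^o}) p b2 : \sum_p' (phi (a' p' * b2) : k) *: T p p' =
    (tpure 1 b2 : A ⊗ B) *: (\sum_p' (phi (a' p') : k) *: T p p' : tensor X Y).
  have sE (d : P' -> k) : \sum_p' d p' *: T p p' = tp (c p q) (\sum_p' d p' *: c'
    p' q').
    by rewrite tp_sumr; apply: eq_bigr => p' _; rewrite tpZr.
  by rewrite !sE c2' tpE scale1r.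
have e1 (phi : {linear A -> k^o}) p' b1 : \sum_p (phi (a p * b1) : k) *: T p p' =
    (tpure b1 1 : A ⊗ B) *: (\sum_p (phi (a p) : k) *: T p p' : tensor X Y).
  have sE (d : P -> k) : \sum_p d p *: T p p' = tp (\sum_p d p *: c p q) (c' p' q').
    by rewrite tp_suml; apply: eq_bigr => p _; rewrite tpZl.
  by rewrite !sE c2 tpE scale1r.
move: b; apply: (@tens_ext _ A B (restr (tensor X Y)) (fun b => _) (fun b =>
  (b : A ⊗ B) *: (_ : tensor X Y))).
- move=> d u v; rewrite scaler_sumr -big_split; apply: eq_bigr => p _ /=.
  have -> : psi ((tpure (a p.1) (a' p.2) : A ⊗ B) * (d *: u + v : A ⊗ B)) =
      d * psi ((tpure (a p.1) (a' p.2) : A ⊗ B) * (u : A ⊗ B)) +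
      psi ((tpure (a p.1) (a' p.2) : A ⊗ B) * (v : A ⊗ B)).
    by rewrite mulrDr -scalerAr linearP.
  by rewrite scalerDl scalerA.
- by move=> d u v; rewrite scalerDl restrZl.
move=> b1 b2.
rewrite -[LHS](pair_bigA _ (fun p p' =>
  (psi ((tpure (a p) (a' p') : A ⊗ B) * tpure b1 b2) : k) *: T p p')) /=.
transitivity ((tpure b1 b2 : A ⊗ B) *: (\sum_p \sum_p'
    (psi (tpure (a p) (a' p')) : k) *: T p p' : tensor X Y)); last first.
  by rewrite (pair_bigA _ (fun p p' => (psi (tpure (a p) (a' p')) : k) *: T p p')).
pose psir x := psi \o lin_of (tpure_linear_r (x : A) : linear (tpure x : B ->
  A ⊗ B)).
pose psil y := psi \o lin_of (tpure_linear_l (y : B) : linear ((fun x =>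
  tpure x y) : A -> A ⊗ B)).
transitivity (\sum_p ((tpure 1 b2 : A ⊗ B) *: (\sum_p'
    (psi (tpure (a p * b1) (a' p')) : k) *: T p p' : tensor X Y) : restr (tensor
      X Y))).
  apply: eq_bigr => p _; rewrite -(e2 (psir (a p * b1))).
  by apply: eq_bigr => p' _; rewrite tpureM.
rewrite -scale_restr_sum exchange_big /=.
transitivity ((tpure 1 b2 : A ⊗ B) *: (\sum_p' ((tpure b1 1 : A ⊗ B) *: (\sum_p
    (psi (tpure (a p) (a' p')) : k) *: T p p' : tensor X Y) : restr (tensor X Y))
      : tensor X Y)).
  apply: (congr1 (fun z : tensor X Y => (tpure 1 b2 : A ⊗ B) *: z)).
  by apply: eq_bigr => p' _; exact: (e1 (psil (a' p'))).
by rewrite -scale_restr_sum scalerA tpureM mul1r mulr1 exchange_big.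
Qed.

Lemma tensor_injective X Y : injective_mod X -> injective_mod Y ->
  injective_mod (tensor X Y).
Proof.
move=> /injective_coinduced_retract rX /injective_coinduced_retract rY.
exact/coinduced_retract_injective/tensor_coinduced_retract.
Qed.

(** X ⊗ Y embeds in I ⊗ Y with cokernel X' ⊗ Y. Here I ⊗ Y need not be injective, but an inner
    induction along the coresolution of [Y] puts it in [fin_inj]. *)
Lemma tensor_fin_inj n m X Y : injdim_le n X -> injdim_le m Y ->
  fin_inj (tensor X Y).
Proof.
elim: n X => [|n IHn] X.
  move=> iX; elim: m Y => [|m IHm] Y /= iY; first exact/fin_inj0/tensor_injective.
  have [J [Y' [iJ s /IHm fY']]] := iY.
  exact: fin_injS (tensor_ses_r X s) (fin_inj0 (tensor_injective iX iJ)) fY'.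
move=> [I [X' [iI s iX']]] iY.
apply: fin_injS (tensor_ses_l Y s) _ (IHn _ iX' iY).
elim: m Y iY {IHn} => [|m IHm] Y iY; first exact/fin_inj0/tensor_injective.
have [J [Y' [iJ s' /IHm fY']]] := iY.
exact: fin_injS (tensor_ses_r I s') (fin_inj0 (tensor_injective iI iJ)) fY'.
Qed.

Lemma tensor_regular_fin_inj : gorenstein A -> gorenstein B ->
  fin_inj (regmod (A ⊗ B)).
Proof.
move=> [/finite_injdim_le[n iA] _] [/finite_injdim_le[m iB] _].
have [Z Z0] := zero_mod (A ⊗ B).
(* Transport along an isomorphism, read as a short exact sequence with zero third term. *)
apply: (@fin_injS _ _ _ (tensor (regmod A) (regmod B)) Z).
- apply: is_ses_iso (iso_refl _) _ (iso_refl _) (ses_zero_r (regmod (A ⊗ B)) Z0).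
  exact/iso_sym/tensor_regular.
- exact: tensor_fin_inj iA iB.
- exact/fin_inj0/injective_zero.
Qed.

End TensorInjective.

(** * Filtrations by tensor products *)

Section TensorResolutions.
Variables (k : fieldType) (A B : falgType k).
Implicit Types (X P : fgmod A) (Y Q : fgmod B).

Definition tensor_set (C : fgmod A -> Prop) (D : fgmod B ->
  Prop) (Z : fgmod (A ⊗ B)) :=
  exists (X : fgmod A) (Y : fgmod B), [/\ C X, D Y & Z = tensor X Y].

(** The variable X is treated first, where the middle terms P ⊗ Q are projective; the resulting
    acyclic modules X ⊗ Q are the middle terms when Y varies. *)
Lemma tensor_projective_ext1_zero X Q N : fin_inj N -> projective Q ->
  coresolved X ->
  ext1_zero (tensor X Q) N.
Proof.
move=> fN pQ cX.
apply: (coresolving_ext1_zero (C := tensor_set (@coresolved _ A) (eq Q))) fN _ _;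
  last first.
  by exists X, Q.
move=> _ [{}X [_ [{}cX <- ->]]].
have [P [X' [pP s cX']]] := coresolved_coresolving cX.
exists (tensor P Q), (tensor X' Q); split; [exact: tensor_ses_l|by exists X', Q|].
by move=> N' _; apply/ext1_zero_projective/tensor_projective.
Qed.

Lemma tensor_ext1_zero X Y N : fin_inj N -> coresolved X -> coresolved Y ->
  ext1_zero (tensor X Y) N.
Proof.
move=> fN cX cY.
apply: (coresolving_ext1_zero (C :=
  tensor_set (@coresolved _ A) (@coresolved _ B))) fN _ _; last first.
  by exists X, Y.
move=> _ [{cX}X [{cY}Y [cX cY ->]]].
have [Q [Y' [pQ s cY']]] := coresolved_coresolving cY.
exists (tensor X Q), (tensor X Y'); split; [exact: tensor_ses_r|by exists X, Y'|].
by move=> N' fN'; exact: tensor_projective_ext1_zero.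
Qed.

Lemma tensor_filtered_coresolved : fin_inj (regmod (A ⊗ B)) ->
  forall Z, filtered (tensor_set (@coresolved _ A) (@coresolved _ B)) Z ->
    coresolved Z.
Proof.
move=> fR; apply: filtered_coresolved => _ [X [Y [cX cY ->]]].
  exact: tensor_ext1_zero.
have [P [X' [pP sX cX']]] := coresolved_coresolving cX.
have [Q [Y' [pQ sY cY']]] := coresolved_coresolving cY.
(* X ⊗ Y lies in P ⊗ Y, which lies in P ⊗ Q; the cokernel of the composite is an extension of P ⊗ Y'
   by X' ⊗ Y. *)
have [C [s1 s2]] := ses_pushout (tensor_ses_l Y sX) (tensor_ses_r P sY).
exists (tensor P Q), C; split=> //; first exact: tensor_projective.
apply: filteredS s2 _; last by exists P, Y'; split=> //;
  exact: coresolved_projective.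
by apply: filtered1; exists X', Y.
Qed.

Definition tensor_gdim n (Z : fgmod (A ⊗ B)) : Prop :=
  exists i j, (i + j <= n)%N /\ tensor_set (@gdim_le _ A i) (@gdim_le _ B j) Z.

Lemma tensor_gdim_syzygies n : syzygies_filtered (tensor_gdim n.+1) (tensor_gdim n).
Proof.
move=> _ [i [j [le_ij [X [Y [gX gY ->]]]]]].
have [KX [P [pP sX]]] := projective_cover X.
have [KY [Q [pQ sY]]] := projective_cover Y.
have gKX := gdim_le_syzygy pP sX gX; have gKY := gdim_le_syzygy pQ sY gY.
have gP : gdim_le 0 P := coresolved_projective pP.
have gQ : gdim_le 0 Q := coresolved_projective pQ.
have pPQ := tensor_projective pP pQ.
(* The syzygy can be made an extension of KX ⊗ Y by P ⊗ KY, or of X ⊗ KY by KX ⊗ Q. The bound for KY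
   drops below that for Y only when j > 0, so the first form is used for j = 0 and the second
   otherwise. *)
case: j => [|j] in le_ij gY gKY *.
  have [K [s1 s2]] := ses_pullback (tensor_ses_r P sY) (tensor_ses_l Y sX).
  exists (tensor P Q), K; split=> //; apply: filteredS s1 _.
    by apply: filtered1; exists 0%N, 0%N; split=> //; exists P, KY.
  exists i.-1, 0%N; split; last by exists KX, Y.
  by rewrite addn0; case: i le_ij {gX gKX} => //= i; rewrite addn0.
have [K [s1 s2]] := ses_pullback (tensor_ses_l Q sX) (tensor_ses_r X sY).
exists (tensor P Q), K; split=> //; apply: filteredS s1 _.
  apply: filtered1; exists i.-1, 0%N; split; last by exists KX, Q.
  rewrite addn0; apply: leq_trans (leq_pred i) _.
  by move: le_ij; rewrite addnS ltnS; exact: leq_trans (leq_addr _ _).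
by exists i, j; split; [move: le_ij; rewrite addnS|exists X, KY].
Qed.

Lemma tensor_gdim_regular n : filtered (tensor_gdim n) (regmod (A ⊗ B)).
Proof.
apply: filtered_iso (tensor_regular A B) _; apply: filtered1.
exists 0%N, 0%N; split=> //; exists (regmod A), (regmod B); split=> //.
  exact/coresolved_projective/regular_projective.
exact/coresolved_projective/regular_projective.
Qed.

End TensorResolutions.

(** * Simple modules, Schur's lemma and tensor submodules *)

Section DimensionInduction.
Variables (k : fieldType) (R : falgType k).
Implicit Types (K M N X Y Z : fgmod R) (C : fgmod R -> Prop).

Lemma ses_dim X Y Z : is_ses X Y Z ->
  dim (restr Y) = (dim (restr X) + dim (restr Z))%N.
Proof.
move=> [f [g [fi fg gs]]].
pose F := linfun (restr_lin f); pose G := linfun (restr_lin g).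
have GE y : G y = g y by rewrite lfunE.
have FE x : F x = f x by rewrite lfunE.
have kF : lker F == 0%VS by apply/lker0P => x y; rewrite !FE => /fi.
have GG : limg G = fullv.
  apply/vspaceP => z; rewrite memvf; have [y <-] := gs z.
  by rewrite -GE memv_img ?memvf.
have FG : limg F = lker G.
  apply/vspaceP => y; rewrite memv_ker GE;
    apply/memv_imgP/eqP => [[x _ ->]|/fg[x <-]].
    by rewrite FE; apply/fg; exists x.
  by exists x; rewrite ?memvf // FE.
rewrite -[LHS]dimvf -(limg_ker_dim G fullv) GG capfv -FG.
by rewrite limg_dim_eq ?dimvf // (eqP kF) capv0.
Qed.

Lemma dim_gt0 M (x : M) : x != 0 -> (0 < dim (restr M))%N.
Proof.
move=> x0; rewrite lt0n; apply: contra x0 => /eqP d0; apply/eqP.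
apply: (@v2r_inj _ (restr M)); rewrite linear0; apply/rowP => i.
by have := ltn_ord i; rewrite [X in (_ < X)%N]d0.
Qed.

Lemma filtered_all C :
    (forall N (x : N), x != 0 ->
      exists Z W, [/\ C Z, is_ses Z N W & exists z : Z, z != 0]) ->
  forall N, filtered C N.
Proof.
move=> CN N; have [n] := ubnP (dim (restr N)); elim: n N => // n IH N lt_n.
case: (pselect (exists x : N, x != 0)) => [[x x0]|no]; last first.
  by apply: filtered0 => x; case: (eqVneq x 0) => // x0; case: no; exists x.
have [Z [W [CZ s [z z0]]]] := CN N x x0.
have dN := ses_dim s; apply: filtered_ext s (filtered1 CZ) (IH W _).
move: lt_n; rewrite dN ltnS; apply: leq_trans.
by rewrite -[X in (X < _)%N]add0n ltn_add2r (dim_gt0 z0).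
Qed.

Lemma simple_submodule M (x : M) : x != 0 ->
  exists (S : fgmod R) (i : {linear S -> M}), simple_mod S /\ injective i.
Proof.
have [n] := ubnP (dim (restr M)); elim: n M x => // n IH M x lt_n x0.
case: (pselect (simple_mod M)) => [sM|nsM]; first by exists M, (lin_id M); split.
have [U [Uc [U0 UT]]] : exists U : {pred M}, GRing.submod_closed U /\
    ((exists2 y, y \in U & y != 0) /\ exists y, y \notin U).
  apply: contrapT => no; apply: nsM; split; first by exists x.
  move=> U Uc; case: (pselect (exists2 y, y \in U & y != 0)) => [U0|n0].
    right=> y; apply/idP; apply: contrapT => /negP yU; apply: no.
    by exists U; split=> //; split=> //; exists y.
  left=> y; rewrite inE; apply/idP/eqP => [yU|->]; last by case: Uc.
  by case: (eqVneq y 0) => // y0; case: n0; exists y.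
have [K [j [ji jE]]] := submodule Uc.
have [W [p jp]] := cokernel_ses ji.
case: U0 => y /jE[u uy] y0; case: UT => w wU.
have [||S [i [sS ii]]] := IH K u.
- move: lt_n; rewrite (ses_dim (ex_intro _ j (ex_intro _ p jp))) ltnS.
  apply: leq_trans; rewrite -[X in (X < _)%N]addn0 ltn_add2l.
  apply: (@dim_gt0 W (p w)); apply: contra wU => /eqP pw.
  by case: jp => _ jpE _; apply/jE; apply/jpE.
- by apply: contra y0 => /eqP u0; rewrite -uy u0 linear0.
by exists S, (j \o i); split=> //; exact: inj_comp.
Qed.

(* Schur: k-independent maps from a simple module with endomorphism algebra k
   are independent over that module. *)
Lemma simple_independent (S M : fgmod R) (f : nat -> {linear S -> M}) n :
    simple_mod S -> splitting_field R ->
    (forall c : nat -> k, (forall s, \sum_(i < n) (c i)%:A *: f i s = 0) ->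
       forall i, (i < n)%N -> c i = 0) ->
  forall s : nat -> S, \sum_(i < n) f i (s i) = 0 -> forall i, (i < n)%N -> s i = 0.
Proof.
move=> sS spl; elim: n => // n IH indep s s0.
have indepn : forall c : nat -> k, (forall s, \sum_(i < n) (c i)%:A *: f i s = 0) ->
    forall i, (i < n)%N -> c i = 0.
  move=> c c0 i lt_in.
  have := indep (fun i => if (i < n)%N then c i else 0) _ i (ltnW lt_in).
  rewrite lt_in; apply=> t;
    rewrite big_ord_recr /= ltnn !scale0r addr0 -[RHS](c0 t).
  by apply: eq_bigr => l _; rewrite ltn_ord.
have {}IH := IH indepn.
suff sn : s n = 0.
  move=> i; rewrite ltnS leq_eqVlt => /predU1P[-> //|]; apply: IH.
  by move: s0; rewrite big_ord_recr /= sn linear0 addr0.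
apply: contrapT => sn0.
(* [T] collects the last entries of all relations. It contains the nonzero [s n], so by simplicity
   it is all of [S]. *)
pose T := [pred x : S | `[< exists t : nat ->
  S, \sum_(i < n.+1) f i (t i) = 0 /\ t n = x >]].
have Tc : GRing.submod_closed T.
  split; first by apply/asboolP; exists (fun=> 0); split=> //;
    apply: big1 => i _; rewrite linear0.
  move=> a x y /asboolP[t [t0 tx]] /asboolP[u [u0 uy]]; apply/asboolP.
  exists (fun i => a *: t i + u i); rewrite tx uy; split=> //.
  under eq_bigr => i _ do rewrite linearP.
  by rewrite big_split -scaler_sumr /= t0 u0 scaler0 addr0.
have TT x : exists t : nat -> S, \sum_(i < n.+1) f i (t i) = 0 /\ t n = x.
  case: sS => _ /(_ T Tc)[T0|/(_ x)/asboolP //].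
  by case: sn0; apply/eqP; rewrite -[_ == _]T0; apply/asboolP; exists s.
have /choice[t tE] := TT.
(* By the induction hypothesis a relation is determined by its last entry [x]; the other entries are
   therefore linear in [x], hence scalar multiples of it by splitting. *)
have tl i (lt_in : (i < n)%N) : linear (fun x => t x i).
  move=> a x y; apply/eqP; rewrite -subr_eq0; apply/eqP.
  apply: (IH (fun i => t (a *: x + y) i - (a *: t x i + t y i))) => //.
  have S0 z : \sum_(l < n) f l (t z l) = - f n z.
    by have [e1 e2] := tE z; move: e1; rewrite big_ord_recr /= e2 => /eqP;
      rewrite addr_eq0 => /eqP.
  under eq_bigr => l _ do rewrite linearB linearP.
  rewrite sumrB big_split -scaler_sumr /= !S0 linearP scalerN opprD.  exact: subrr.
have /choice[c cE] (i : nat) : exists c : k, (i < n)%N ->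
  forall x, t x i = c%:A *: x.
  case: (ltnP i n) => [lt_in|_]; last by exists 0.
  by have [c [cE _]] := spl S sS (lin_of (tl i lt_in)); exists c => _.
(* Now the relation has scalar coefficients, with coefficient 1 at [f n], against k-independence. *)
have H x : \sum_(i < n.+1) (if (i < n)%N then c i else 1)%:A *: f i x = 0.
  have [t0 tn] := tE x; rewrite -[RHS]t0 !big_ord_recr /= ltnn !scale1r tn;
    congr (_ + _).
  by apply: eq_bigr => i _; rewrite ltn_ord (cE i) ?linearZ.
by have := indep (fun i => if (i < n)%N then c i else 1) H n (ltnSn n);
  rewrite /= ltnn => /eqP; rewrite oner_eq0.
Qed.

End DimensionInduction.

Section RestrictionOfScalars.
Variables (k : fieldType) (R T : falgType k) (j : {linear R -> T}).
Hypothesis jM : forall a b : R, j (a * b) = j a * j b.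
Hypothesis j1 : j 1 = 1.
Variable N : fgmod T.

Let act (a : R) (v : restr N) : restr N := j a *: (v : N).

Let actl v : linear (act^~ v).
Proof. by move=> c a b; rewrite /act linearP scalerDl restrZl. Qed.

Let actr a : linear (act a).
Proof. by move=> c u v; rewrite /act scalerDr restrZC. Qed.

Let actM' a b v : act (a * b) v = act a (act b v).
Proof. by rewrite /act jM scalerA. Qed.

Let act1' v : act 1 v = v.
Proof. by rewrite /act j1 scale1r. Qed.

Definition scalar_restriction : fgmod R := actfg (Action actl actr actM' act1').

Lemma scalar_restrictionE a (v : scalar_restriction) : a *: v = j a *: (v : N).
Proof. by []. Qed.

End RestrictionOfScalars.

Section HomModule.
Variables (k : fieldType) (R T : falgType k) (j : {linear R -> T}).
Hypothesis jM : forall a b : R, j (a * b) = j a * j b.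
Hypothesis j1 : j 1 = 1.
Variables (V : vectType k) (N : fgmod T).

Let act (a : R) (f : 'Hom(V, restr N)) : 'Hom(V, restr N) :=
  linfun (scale_restr N (j a) \o f).

Let actE a f v : act a f v = j a *: (f v : N).
Proof. exact: lfunE. Qed.

Let actl f : linear (act^~ f).
Proof.
move=> c a b; apply/lfunP => v; rewrite add_lfunE scale_lfunE !actE.
by rewrite linearP scalerDl restrZl.
Qed.

Let actr a : linear (act a).
Proof.
move=> c f g; apply/lfunP => v;
  rewrite add_lfunE scale_lfunE !actE add_lfunE scale_lfunE.
by rewrite scalerDr restrZC.
Qed.

Let actM' a b f : act (a * b) f = act a (act b f).
Proof. by apply/lfunP => v; rewrite !actE jM scalerA. Qed.

Let act1' f : act 1 f = f.
Proof. by apply/lfunP => v; rewrite actE j1 scale1r. Qed.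

Definition hom_module : fgmod R := actfg (Action actl actr actM' act1').

Definition hom_app (f : hom_module) (v : V) : restr N := (f : 'Hom(V, restr N)) v.

Lemma hom_app_scale a (f : hom_module) v : hom_app (a *: f) v = j a *: (hom_app f
  v : N).
Proof. exact: actE. Qed.

Lemma hom_app_bilin : bilin (U := restr hom_module) hom_app.
Proof.
split=> [v|f] c x y; last by rewrite /hom_app linearP.
by rewrite /hom_app restr_actmod add_lfunE scale_lfunE.
Qed.

Lemma hom_app_inj (f : hom_module) : (forall v, hom_app f v = 0) -> f = 0.
Proof.
by move=> f0; apply/(@lfunP k V (restr N)) => v; rewrite zero_lfunE; exact: f0.
Qed.

Lemma hom_app_ex (f : {linear V ->
  restr N}) : exists g : hom_module, forall v, hom_app g v = f v.
Proof. by exists (linfun f) => v; exact: lfunE. Qed.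

End HomModule.

Section Isotypic.
Variables (k : fieldType) (R R' T : falgType k).
Variables (j : {linear R -> T}) (j' : {linear R' -> T}).
Hypothesis jM : forall a b : R, j (a * b) = j a * j b.
Hypothesis j1 : j 1 = 1.
Hypothesis j'M : forall a b : R', j' (a * b) = j' a * j' b.
Hypothesis j'1 : j' 1 = 1.
Hypothesis jC : forall a b, j a * j' b = j' b * j a.

(** [X] is Hom_R(S, N) for a simple R-submodule [S] of [N], and [f] is evaluation; the third clause
    is injectivity of X ⊗ S → N in coordinates. Stating it for commuting maps [j] and [j'] serves
    whichever of A and B is split. *)
Lemma simple_isotypic (N : fgmod T) (x0 : N) : splitting_field R -> x0 != 0 ->
  exists (S : fgmod R) (X : fgmod R') (f : restr X -> restr S -> restr N),
    [/\ bilin f,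
        forall a b (x : X) (s : S), f (b *: x) (a *: s) = (j' b * j a) *: (f x s
          : N),
        forall s : 'I_(dim (restr X)) -> restr S,
          \sum_i f (tbase i) (s i) = 0 -> forall i, s i = 0
      & exists x s, f x s != 0].
Proof.
move=> spl x0n; pose M := scalar_restriction jM j1 N.
have [S [i [sS ii]]] := simple_submodule (x0n : (x0 : M) != 0).
pose H := hom_module j'M j'1 (restr S) N.
have [hl hr] := hom_app_bilin j'M j'1 (restr S) N.
(* As [j] and [j'] commute, the R-linear maps form an R'-submodule of Hom_k(S, N). *)
pose P := [pred f : H | `[< forall a (s : S), hom_app f (a *: s : S) = j a *:
  (hom_app f s : N) >]].
have [|X [iota [iotai iotaE]]] := submodule (M := H) (S := P).
  split.
    apply/asboolP => a s;
      have h0 t : hom_app (0 : H) t = 0 by exact: (linear0 (lin_of (hl t))).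
    by rewrite !h0 scaler0.
  move=> b f g /asboolP fP /asboolP gP; apply/asboolP => a s.
  have hD (x y : H) t : hom_app (x + y) t = hom_app x t + hom_app y t.
    by have := linearD (lin_of (hl t)) x y.
  by rewrite !hD !hom_app_scale fP gP scalerDr !scalerA jC.
pose f (x : restr X) (s : restr S) : restr N := hom_app (iota x) s.
have bf : bilin f.
  split=> [s|x] c u v; last by rewrite /f (hr (iota x)).
  by rewrite /f -(hl s); congr (hom_app _ s); exact: (linearP (restr_lin iota)).
have fS a (x : X) (s : S) : f x (a *: s : S) = j a *: (f x s : N).
  have /iotaE/asboolP : exists y, iota y = iota x by exists x.
  exact.
exists S, X, f; split=> //.
- by move=> a b x s; rewrite fS /f linearZ /= hom_app_scale scalerA jC.
- move=> s s0.
  have lf x : linear (f x : S -> M).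
    move=> a u v; have /= -> := linearD (lin_of (bf.2 x)) (a *: u : S) v.
    by rewrite [X in X + _]fS.
  pose n := dim (restr X); pose e (l : 'I_n) : restr X := @tbase _ (restr X) l.
  (* [simple_independent] takes families indexed by [nat]; beyond [n] the map is set to 0. *)
  have /choice[g gE] (l : nat) : exists g : {linear S -> M},
      forall (lt_ln : (l < n)%N) t, g t = f (e (Ordinal lt_ln)) t.
    case: (pselect (l < n)%N) => [lt_ln|no]; last by exists (lin0 S M) => lt_ln;
      case: no.
    exists (lin_of (lf (e (Ordinal lt_ln)))) => lt_ln' t /=.
    by rewrite (bool_irrelevance lt_ln' lt_ln).
  have gfE (l : 'I_n) t : g l t = f (e l) t.
    by rewrite (gE l (ltn_ord l)); congr (f (e _) _); exact: val_inj.
  have indep : forall c : nat ->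
    k, (forall t, \sum_(l < n) (c l)%:A *: g l t = 0) ->
      forall l, (l < n)%N -> c l = 0.
    move=> c c0 l lt_ln.
    have : \sum_(l < n) c l *: e l = 0.
      apply: iotai; rewrite linear0; apply: hom_app_inj => t.
      rewrite -[LHS]/(lin_of (bf.1 t) _) linear_sum -[RHS](c0 t).
      apply: eq_bigr => m _; rewrite linearZ /= gfE scalar_restrictionE.
      by rewrite linearZ j1.
    have -> : \sum_(l < n) c l *: e l = r2v (\row_l c l).
      by rewrite [RHS]tbaseE; apply: eq_bigr => m _; rewrite r2vK mxE.
    move=> /(congr1 v2r); rewrite r2vK linear0 => /rowP/(_ (Ordinal lt_ln)).
    by rewrite !mxE.
  pose s' (l : nat) : S := if insub l is Some m then s m else 0.
  have s'E (l : 'I_n) : s' l = s l by rewrite /s' valK.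
  have := @simple_independent _ _ S M g n sS spl indep s' _.
  move=> H0 l; rewrite -s'E; apply: H0 => //.
  by rewrite -[RHS]s0; apply: eq_bigr => m _; rewrite gfE s'E.
(* The inclusion of [S] is itself an element of [X], which shows that evaluation is not zero. *)
have li : linear (i : restr S -> restr N).
  move=> c u v; have := linearP (restr_lin i) c u v => /= ->.
  by rewrite restr_actmod.
have [h hE] := hom_app_ex j'M j'1 (lin_of li).
have /iotaE[x xE] : h \in P.
  by apply/asboolP => a s; rewrite !hE /= linearZ.
have [[s s0] _] := sS; exists x, s.
by rewrite /f xE hE /=; apply: contra s0 => /eqP/(inj0 ii) ->.
Qed.

End Isotypic.

Section SplittingField.
Variables (k : fieldType) (A B : falgType k).

Let inA : {linear A -> A ⊗ B} :=
  lin_of (tpure_linear_l (1 : B) : linear ((fun a : A => tpure a 1) : A -> A ⊗ B)).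
Let inB : {linear B -> A ⊗ B} :=
  lin_of (tpure_linear_r (1 : A) : linear ((fun b : B => tpure 1 b) : B -> A ⊗ B)).

Let inAM a b : inA (a * b) = inA a * inA b.
Proof. by rewrite [RHS]tpureM mulr1. Qed.
Let inBM a b : inB (a * b) = inB a * inB b.
Proof. by rewrite [RHS]tpureM mulr1. Qed.
Let inAB a b : inA a * inB b = tpure a b.
Proof. by rewrite [LHS]tpureM mulr1 mul1r. Qed.
Let inBA a b : inB b * inA a = tpure a b.
Proof. by rewrite [LHS]tpureM mulr1 mul1r. Qed.

(** Writes a tensor in the form to which the independence clause of [simple_isotypic] applies. *)
Lemma tens_sum_l (U V : vectType k) (z : tens U V) :
  exists v : 'I_(dim U) -> V, z = \sum_i tpure (tbase i) (v i).
Proof.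
exists (fun i => \sum_j (z : 'M_(_, _)) i j *: tbase j); rewrite [LHS]tens_basis.
apply: eq_bigr => i _;
  rewrite -[RHS]/(lin_of (tpure_linear_r (tbase i)) _) linear_sum.
by apply: eq_bigr => j _; rewrite linearZ.
Qed.

Lemma tens_sum_r (U V : vectType k) (z : tens U V) :
  exists u : 'I_(dim V) -> U, z = \sum_j tpure (u j) (tbase j).
Proof.
exists (fun j => \sum_i (z : 'M_(_, _)) i j *: tbase i);
  rewrite [LHS]tens_basis exchange_big.
apply: eq_bigr => j _;
  rewrite -[RHS]/(lin_of (tpure_linear_l (tbase j)) _) linear_sum.
by apply: eq_bigr => i _; rewrite linearZ.
Qed.

Lemma tensor_submodule_r (N : fgmod (A ⊗ B)) (x0 : N) : splitting_field B ->
  x0 != 0 ->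
  exists (X : fgmod A) (Y : fgmod B) (W : fgmod (A ⊗ B)),
    is_ses (tensor X Y) N W /\ exists z : tensor X Y, z != 0.
Proof.
move=> spl x0n.
have [|S [X [f [bf fE fi [x [s f0]]]]]] :=
  @simple_isotypic k B A (A ⊗ B) inB inA inBM (erefl _) inAM (erefl _) _ N x0 spl
    x0n.
  by move=> b a; rewrite inAB inBA.
have [|h hE] := tensor_lift bf; first by move=> a b y t; rewrite fE inAB.
have hi : injective h.
  apply: lin_inj => z; have [v ->] := @tens_sum_l (restr X) (restr S) z.
  rewrite (linear_sum h) => h0; rewrite big1 // => i _.
  rewrite (fi v) ?tpure0r // -[RHS]h0; apply: eq_bigr => l _.
  by rewrite -hE.
have [W [g hg]] := cokernel_ses hi.
exists X, S, W; split; first by exists h, g.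
by exists (tp x s); apply: contra f0 => /eqP e; rewrite -hE e linear0.
Qed.

Lemma tensor_submodule_l (N : fgmod (A ⊗ B)) (x0 : N) : splitting_field A ->
  x0 != 0 ->
  exists (X : fgmod A) (Y : fgmod B) (W : fgmod (A ⊗ B)),
    is_ses (tensor X Y) N W /\ exists z : tensor X Y, z != 0.
Proof.
move=> spl x0n.
have [|S [X [f [[bl br] fE fi [x [s f0]]]]]] :=
  @simple_isotypic k A B (A ⊗ B) inA inB inAM (erefl _) inBM (erefl _) _ N x0 spl
    x0n.
  by move=> a b; rewrite inAB inBA.
have bf : bilin (fun s x => f x s) by split.
have [|h hE] := tensor_lift bf; first by move=> a b y t; rewrite fE inBA.
have hi : injective h.
  apply: lin_inj => z; have [v ->] := @tens_sum_r (restr S) (restr X) z.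
  rewrite (linear_sum h) => h0; rewrite big1 // => i _.
  rewrite (fi v) ?tpure0l // -[RHS]h0; apply: eq_bigr => l _.
  by rewrite -(hE (v l)).
have [W [g hg]] := cokernel_ses hi.
exists S, X, W; split; first by exists h, g.
by exists (tp s x); apply: contra f0 => /eqP e; rewrite -hE e linear0.
Qed.

(** The bounds [m] and [n] hold for all modules, so every nonzero tensor submodule is an admissible
    bottom step and induction on dimension applies. *)
Lemma tensor_gdim_filtered m n :
    (forall X : fgmod A, gdim_le m X) -> (forall Y : fgmod B, gdim_le n Y) ->
    splitting_field A \/ splitting_field B ->
  forall N, filtered (@tensor_gdim k A B (m + n)) N.
Proof.
move=> gA gB spl; apply: filtered_all => N x x0.
have [X [Y [W [s z]]]] : exists (X : fgmod A) (Y : fgmod B) (W : fgmod (A ⊗ B)),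
    is_ses (tensor X Y) N W /\ exists z : tensor X Y, z != 0.
  by case: spl => spl; [exact: tensor_submodule_l x0|exact: tensor_submodule_r x0].
by exists (tensor X Y), W; split=> //; exists m, n; split=> //; exists X, Y.
Qed.

End SplittingField.

Theorem theoremB (k : fieldType) (A B : falgType k) :
  gorenstein A -> gorenstein B ->
  splitting_field A \/ splitting_field B ->
  forall M : fgmod (A ⊗ B),
    gproj M <-> filtbar (tensor_class (@gproj A) (@gproj B)) M.
Proof.
move=> gA gB spl M.
have fR := tensor_regular_fin_inj gA gB; rewrite gprojE // filtbarE.
have fin (R : falgType k) : gorenstein R -> fin_inj (regmod R).
  by move=> [/finite_injdim_le[n /injdim_le_fin_inj]].
have gE (R : falgType k) (X : fgmod R) : gorenstein R -> gproj X <-> coresolved X.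
  by move=> /fin; exact: gprojE.
split=> [cM|[N fMN]].
  have [m mA] := gorenstein_gdim_le gA; have [n nB] := gorenstein_gdim_le gB.
  have [|N fN] := coresolved_filtered_summand (@tensor_gdim_syzygies k A B)
    (@tensor_gdim_regular k A B) _ cM.
    by exists (m + n)%N; exact: tensor_gdim_filtered.
  (* At index 0 both dimension bounds are 0, so the two factors are coresolved, that is, Gorenstein
     projective. *)
  exists N; apply: sub_filtered fN => Z [i [j [le_ij [X [Y [gX gY ->]]]]]].
  apply: filtered1; move: le_ij gX gY; rewrite leqn0 addn_eq0.
  move=> /andP[/eqP -> /eqP ->] gX gY; exists X, Y.
  by split; [exact/gE|exact/gE|exact: tensor_is_tensor].
apply: (coresolved_summand fR (N := N)).
apply: tensor_filtered_coresolved fR _ _; apply: sub_filtered fMN => Z.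
move=> /tensor_classE[X [Y [/(gE _ _ gA) cX /(gE _ _ gB) cY iso]]].
by apply: filtered_iso iso _; apply: filtered1; exists X, Y.
Qed.
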